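(* There exist problem-independent constants $C,C_1,C_2>0$ such that the following holds. Suppose that $\epsilon,\delta\in(0,1)$, $s\in\mathbb{N}^+$, $r\le d\le n$ and $m\le n$ are positive integers with $n$ a power of $2$, and $E>0$ satisfy $$C\le E\le\frac{2e^{4r}}{[4r+\log(1/\delta)]\,\delta},\qquad m\ge E\,C_2^{-2}\epsilon^{-2}[4r+\log(1/\delta)].$$ Let $\delta_1\in(0,1)$ and suppose further that $$n\ge\frac{\left(\sqrt{r}+\sqrt{8\log(n/\delta_1)}\right)^2}{s\,\bar\mu(\epsilon,\delta)^2},$$ where $$\bar\mu(\epsilon,\delta)=C_1\sqrt{C_2}\sqrt{\epsilon}\,\min\left\{\frac{\log(E/(C_2\epsilon))}{4r+\log(1/\delta)},\ \sqrt{\frac{\log E}{4r+\log(1/\delta)}}\right\}.$$ Then for any matrix $A\in\mathbb{R}^{n\times d}$ with rank $r$, a Hashed-Randomised-Hadamard-Transform (HRHT) matrix $S=S_hHD\in\mathbb{R}^{m\times n}$, with $S_h$ an $s$-hashing variant matrix, is an $\epsilon$-subspace embedding for $A$ with probability at least $(1-\delta)(1-\delta_1)$.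
   Context: HRHT: an $m\times n$ random matrix $S=S_hHD$ with $m\le n$, where $D$ is a random $n\times n$ diagonal matrix with independent $\pm1$ (equal probability) diagonal entries; $H$ is the $n\times n$ Walsh–Hadamard matrix $H_{ij}=n^{-1/2}(-1)^{\langle(i-1)_2,(j-1)_2\rangle}$, where $(k)_2$ is the binary representation vector of $k$; and $S_h$ is a random $m\times n$ $s$-hashing variant matrix independent of $D$. $s$-hashing variant matrix: a random matrix $T\in\mathbb{R}^{m\times n}$ such that, independently for each column $j\in\{1,\dots,n\}$, indices $i_1,\dots,i_s\in\{1,\dots,m\}$ are sampled uniformly at random with replacement and, starting from zero, $\pm1/\sqrt{s}$ (independent signs, equal probability) is added to $T_{i_kj}$ for each $k=1,\dots,s$. $S$ is an $\epsilon$-subspace embedding for $A$ if $(1-\epsilon)\|Ax\|_2^2\le\|SAx\|_2^2\le(1+\epsilon)\|Ax\|_2^2$ for all $x\in\mathbb{R}^d$. *)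

(* Defs.v *)
From mathcomp Require Import all_boot all_order all_algebra.
From mathcomp Require Import all_classical all_reals all_analysis.

Set Implicit Arguments.
Unset Strict Implicit.
Unset Printing Implicit Defensive.

Import Order.TTheory GRing.Theory Num.Theory.

Local Open Scope classical_set_scope.
Local Open Scope ring_scope.

Definition norm2 (R : realType) (k : nat) (v : 'cV[R]_k) : R :=
  Num.sqrt (\sum_i v i ord0 ^+ 2).

Definition subspace_embedding (R : realType) (m n d : nat) (eps : R)
    (S : 'M[R]_(m, n)) (A : 'M[R]_(n, d)) : Prop :=
  forall x : 'cV[R]_d,
    (1 - eps) * norm2 (A *m x) ^+ 2 <= norm2 (S *m A *m x) ^+ 2
      <= (1 + eps) * norm2 (A *m x) ^+ 2.

Definition binary_digit (b k : nat) : bool := odd (k %/ 2 ^ b).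

(* Ordinals start at 0, so they play the role of i - 1 for i in {1, ..., n}.
   The numbers 0, ..., n - 1 have at most up_log 2 n binary digits, which is
   exactly log_2 n when n is a power of 2. *)
Definition walsh_hadamard (R : realType) (n : nat) : 'M[R]_n :=
  \matrix_(i, j) ((Num.sqrt n%:R)^-1 *
    (-1) ^+ (\sum_(b < up_log 2 n) binary_digit b i * binary_digit b j)%N).

Section Randomness.
Context {disp : measure_display} {Omega : measurableType disp} {R : realType}.
Variable P : probability Omega R.

(* Every random element below takes finitely many values, so its value space
   carries the discrete sigma-algebra. *)
Definition discrete_rv (T : Type) (X : Omega -> T) : Prop :=
  forall B : set T, measurable (X @^-1` B).

Definition sigma_rv (T : Type) (X : Omega -> T) : set_system Omega :=
  [set X @^-1` B | B in [set: set T]].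

Definition mutually_independent (I : finType) (F : I -> set_system Omega) :
    Prop :=
  forall (J : {set I}) (B : I -> set Omega),
    (forall i, i \in J -> F i (B i)) ->
    P (\bigcap_(i in [set` J]) B i) = (\prod_(i in J) P (B i))%E.

Definition independent_rv (T U : Type) (X : Omega -> T) (Y : Omega -> U) :
    Prop :=
  mutually_independent
    (fun b : bool => if b then sigma_rv X else sigma_rv Y).

Definition random_sign (x : Omega -> R) : Prop :=
  [/\ discrete_rv x,
      (forall w, x w = 1 \/ x w = -1),
      P (x @^-1` [set 1]) = (2^-1)%:E
    & P (x @^-1` [set -1]) = (2^-1)%:E].

Definition uniform_index (m : nat) (i : Omega -> 'I_m) : Prop :=
  discrete_rv i /\ forall a : 'I_m, P (i @^-1` [set a]) = (m%:R^-1)%:E.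

Definition random_sign_diagonal (n : nat) (D : Omega -> 'M[R]_n) : Prop :=
  exists x : 'I_n -> Omega -> R,
    [/\ (forall j, random_sign (x j)),
        mutually_independent (fun j => sigma_rv (x j))
      & forall w, D w = diag_mx (\row_j x j w)].

(* idx j k and sgn j k are the row index and the sign of the k-th draw in
   column j; repeated indices accumulate. The index type of the independent
   family is the disjoint union of the labels of the indices and of those of
   the signs. *)
Definition hashing_variant (m n s : nat) (T : Omega -> 'M[R]_(m, n)) : Prop :=
  exists (idx : 'I_n -> 'I_s -> Omega -> 'I_m)
         (sgn : 'I_n -> 'I_s -> Omega -> R),
    [/\ (forall j k, uniform_index (idx j k)),
        (forall j k, random_sign (sgn j k)),
        mutually_independent
          (fun u : ('I_n * 'I_s) + ('I_n * 'I_s) =>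
             match u with
             | inl p => sigma_rv (idx p.1 p.2)
             | inr p => sigma_rv (sgn p.1 p.2)
             end)
      & forall w, T w = \matrix_(i, j)
          \sum_(k < s | idx j k w == i) (sgn j k w / Num.sqrt s%:R)].

Definition HRHT (m n s : nat) (S : Omega -> 'M[R]_(m, n)) : Prop :=
  (m <= n)%N /\
  exists (Sh : Omega -> 'M[R]_(m, n)) (D : Omega -> 'M[R]_n),
    [/\ hashing_variant s Sh,
        random_sign_diagonal D,
        independent_rv Sh D
      & forall w, S w = Sh w *m walsh_hadamard R n *m D w].

End Randomness.

Definition mu_bar (R : realType) (C1 C2 E : R) (r : nat) (eps delta : R) : R :=
  C1 * Num.sqrt C2 * Num.sqrt eps *
  Num.min (ln (E / (C2 * eps)) / (4 * r%:R + ln delta^-1))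
          (Num.sqrt (ln E / (4 * r%:R + ln delta^-1))).

(* Main.v *)
Require Import Defs.
From mathcomp Require Import all_boot all_order all_algebra.
From mathcomp Require Import all_classical all_reals all_analysis.
From mathcomp Require Import ring lra zify.

(** Splitting column j of S_h into its s draws turns S_h into a feature hash of
the N = n s coordinates y_(j,k) = x_j / sqrt s, so that |S_h x|^2 - |x|^2 is a
Rademacher chaos Z = sum_i (X_i^2 - w_i) over the m buckets, X_i being the signed
sum of the coordinates hashed to i and w_i the sum of their squares.
Colouring the coordinates at random decouples Z into 4 sum_i X_(i,0) X_(i,1),
which amounts to hashing into 2m buckets. All mixed moments of the bucket sums
are dominated by those of independent buckets, whose moments are controlled by
an exponential generating function. A moment of order q comparable to
4 r + ln (1/delta) then gives P(|Z| > eps/3) <= exp (- 5 (4 r + ln (1/delta)))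
for unit vectors whose entries are bounded by a multiple of mu_bar; of the two
terms of the minimum in mu_bar, the first keeps the generating function bounded
at all orders up to q and the second makes its sum over the buckets small.
Hoeffding's inequality shows that H D makes all vectors of a grid in R^r
simultaneously flat, and a quadratic form which is small on that grid is small
everywhere, so that union bounds over the 2^(18 r) grid points conclude. *)

Set Implicit Arguments.
Unset Strict Implicit.
Unset Printing Implicit Defensive.

Import Order.TTheory GRing.Theory Num.Theory.

Local Open Scope classical_set_scope.
Local Open Scope ring_scope.

(** * Uniform averages over finite types *)

(** All estimates are made under uniform laws on finite types and transferred to [P] at the end. On
    an empty type the value is 0. *)
Definition avg (R : realFieldType) (I : finType) (F : I -> R) : R :=
  #|I|%:R^-1 * \sum_i F i.

Section Avg.
Variable R : realFieldType.
Implicit Types I J : finType.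

Lemma eq_avg I (F G : I -> R) : F =1 G -> avg F = avg G.
Proof. by move=> FG; rewrite /avg (eq_bigr _ (fun i _ => FG i)). Qed.

Lemma le_avg I (F G : I -> R) : (forall i, F i <= G i) -> avg F <= avg G.
Proof. by move=> FG; rewrite ler_wpM2l ?invr_ge0// ler_sum. Qed.

Lemma avgZ I (a : R) (F : I -> R) : avg (fun i => a * F i) = a * avg F.
Proof. by rewrite /avg -mulr_sumr mulrCA. Qed.

Lemma avg_sum I (A : Type) (r : seq A) (P : pred A) (F : A -> I -> R) :
  avg (fun i => \sum_(a <- r | P a) F a i) = \sum_(a <- r | P a) avg (F a).
Proof. by rewrite /avg exchange_big mulr_sumr. Qed.

Lemma avg_prod I J (F : I * J -> R) :
  avg F = avg (fun i => avg (fun j => F (i, j))).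
Proof.
rewrite /avg -mulr_sumr mulrA -invfM -natrM -card_prod pair_big.
by congr (_ * _); apply: eq_bigr => -[].
Qed.

Lemma avg_cst I (a : R) : (0 < #|I|)%N -> avg (fun _ : I => a) = a.
Proof.
move=> I0; rewrite /avg sumr_const -[a *+ _]mulr_natr mulrCA mulVf ?mulr1//.
by rewrite pnatr_eq0 -lt0n.
Qed.

Lemma avg_bool (F : bool -> R) : avg F = (F true + F false) / 2.
Proof. by rewrite /avg big_bool card_bool mulrC. Qed.

Lemma avg_bij I J (f : I -> J) (F : J -> R) :
  bijective f -> avg (fun i => F (f i)) = avg F.
Proof.
move=> bf; rewrite /avg (bij_eq_card bf); congr (_ * _).
by rewrite [RHS](reindex f) //; apply: onW_bij.
Qed.

Lemma avg_sqr_le I (F : I -> R) : avg F ^+ 2 <= avg (fun i => F i ^+ 2).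
Proof.
have [I0|I0] := posnP #|I|.
  by rewrite /avg I0 invr0 !mul0r expr0n.
rewrite -subr_ge0.
have -> : avg (fun i => F i ^+ 2) - avg F ^+ 2 = avg (fun i => (F i - avg F) ^+ 2).
  set c := avg F.
  rewrite (@eq_avg _ (fun i => (F i - c) ^+ 2)
    (fun i => \sum_(b : 'I_3) [:: F i ^+ 2; (- 2 * c) * F i; c ^+ 2]`_b)).
    rewrite avg_sum !big_ord_recr big_ord0/= avgZ avg_cst// -/c; ring.
  by move=> i; rewrite !big_ord_recr big_ord0 /=; ring.
by rewrite mulr_ge0 ?invr_ge0// sumr_ge0// => i _; exact: sqr_ge0.
Qed.

(** Iterating the case of squares, with the induction hypothesis applied to the square of [F], gives
    Jensen's inequality for the exponents 2^e. *)
Lemma avg_pow2_le I (F : I -> R) e :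
  avg F ^+ (2 ^ e) <= avg (fun i => F i ^+ (2 ^ e)).
Proof.
elim: e F => [|e IH] F; first by rewrite expn0 expr1.
have -> : avg (fun i => F i ^+ (2 ^ e.+1)) = avg (fun i => (F i ^+ 2) ^+ (2 ^ e)).
  by apply: eq_avg => i; rewrite expnS exprM.
apply: le_trans (IH _); rewrite expnS exprM.
by rewrite lerXn2r ?nnegrE ?sqr_ge0 ?avg_sqr_le//
  mulr_ge0 ?invr_ge0// sumr_ge0// => i _; exact: sqr_ge0.
Qed.

End Avg.

(** * Resampling one value of a uniform function *)

Section Resample.
Variables (R : realFieldType) (T C : finType).
Definition update (c : {ffun T -> C}) a v : {ffun T -> C} :=
  [ffun a' => if a' == a then v else c a'].

(** Exchanging the old value [c a] with a fresh value [v] is an involution of the pairs (c, v), so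
    it preserves the uniform law. *)
Lemma avg_update (F : {ffun T -> C} -> R) a : (0 < #|C|)%N ->
  avg F = avg (fun c => avg (fun v => F (update c a v))).
Proof.
move=> C0; rewrite -(@avg_prod _ _ _ (fun cv => F (update cv.1 a cv.2))).
pose f (cv : {ffun T -> C} * C) := (update cv.1 a cv.2, cv.1 a).
have fK : involutive f.
  case=> c v; rewrite /f/= ffunE eqxx; congr (_, _).
  by apply/ffunP => b; rewrite !ffunE; case: eqP => // ->.
rewrite (@avg_bij _ _ _ f (fun cv => F cv.1) (inv_bij fK)) avg_prod.
by apply: eq_avg => c /=; rewrite avg_cst.
Qed.
End Resample.

(** * Mixed moments of the bucket sums *)

Section Moments.
Variable R : realFieldType.

(* Moments of a sum of independent terms sigma_a eta_a y_a, with sigma_a a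
   random sign and eta_a a Bernoulli variable of parameter p. *)
Fixpoint mu (p : R) (l : seq R) (k : nat) : R :=
  if l is y :: l' then
    mu p l' k +
    p * \sum_(i < k.+1 | (0 < i)%N && ~~ odd i) mu p l' (k - i) * y ^+ i *+ 'C(k, i)
  else (k == 0%N)%:R.

Lemma even_exp_ge0 (y : R) i : ~~ odd i -> 0 <= y ^+ i.
Proof. exact: exprn_even_ge0. Qed.

Lemma mu_ge0 p l k : 0 <= p -> 0 <= mu p l k.
Proof.
move=> p0; elim: l k => [|y l IH] k /=; first by rewrite ler0n.
rewrite addr_ge0// mulr_ge0// sumr_ge0// => i /andP[_ ei].
by rewrite mulrn_wge0// mulr_ge0// even_exp_ge0.
Qed.

Lemma mu0 p l : mu p l 0 = 1.
Proof.
elim: l => [|y l IH] /=; first by [].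
by rewrite IH big1 ?mulr0 ?addr0// => -[[|i] i1].
Qed.

Definition bsign (b : bool) : R := (-1) ^+ b.

Lemma avg_sign_exp (x y : R) k :
  avg (fun b => (x + bsign b * y) ^+ k) =
  \sum_(i < k.+1 | ~~ odd i) x ^+ (k - i) * y ^+ i *+ 'C(k, i).
Proof.
rewrite avg_bool !exprDn -big_split/= mulr_suml [RHS]big_mkcond/=.
apply: eq_bigr => i _; rewrite /bsign expr1 expr0 mul1r mulN1r [(- y) ^+ _]exprNn.
rewrite -mulrnDl -mulrDr -signr_odd; case: (odd i) => /=.
  by rewrite expr1 mulN1r addNr mulr0 mul0rn mul0r.
by rewrite expr0 mul1r -mulr2n -mulrnAr -mulr_natr -mulr_natr; field.
Qed.

(** Of the expanded product only the terms of degree at most one in [v] are kept. They describe a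
    coordinate that lands in a single bucket, whereas the full product describes independent
    buckets. *)
Lemma prod_add_ge (J : finType) (u v : J -> R) :
  (forall j, 0 <= u j) -> (forall j, 0 <= v j) ->
  \prod_j u j + \sum_j v j * \prod_(i | i != j) u i <= \prod_j (u j + v j).
Proof.
move=> u0 v0.
suff H (s : seq J) : uniq s ->
  \prod_(j <- s) u j + \sum_(j <- s) v j * \prod_(i <- s | i != j) u i
   <= \prod_(j <- s) (u j + v j) by exact: H (index_enum_uniq J).
elim: s => [|a s IH]; first by rewrite !big_nil addr0.
move=> /= /andP[as_ us]; rewrite !big_cons eqxx/=.
have -> : \prod_(i <- s | i != a) u i = \prod_(i <- s) u i.
  rewrite big_seq_cond [RHS]big_seq; apply: eq_bigl => i.
  by case: (boolP (i \in s)) => //= is_; apply: contraNneq as_ => <-.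
have -> : \sum_(j <- s) v j * \prod_(i <- a :: s | i != j) u i =
   u a * \sum_(j <- s) v j * \prod_(i <- s | i != j) u i.
  rewrite mulr_sumr big_seq [RHS]big_seq; apply: eq_bigr => j js.
  rewrite big_cons; case: eqP => [aj|_] /=; last by rewrite mulrCA.
  by rewrite aj js in as_.
have P0 : 0 <= \prod_(i <- s) u i by rewrite prodr_ge0.
have S0 : 0 <= \sum_(j <- s) v j * \prod_(i <- s | i != j) u i.
  by rewrite sumr_ge0// => j _; rewrite mulr_ge0// prodr_ge0.
apply: le_trans (ler_wpM2l (addr_ge0 (u0 a) (v0 a)) (IH us)).
have := mulr_ge0 (v0 a) S0; rewrite !mulrDl !mulrDr; lra.
Qed.

Variables (T J : finType) (y : T -> R).
Hypothesis J0 : (0 < #|J|)%N.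
Let p : R := #|J|%:R^-1.

Definition bucket (l : seq T) (c : {ffun T -> J * bool}) (j : J) : R :=
  \sum_(a <- l) ((c a).1 == j)%:R * bsign (c a).2 * y a.

Lemma bucket_update l a c v j : a \notin l ->
  bucket (a :: l) (update c a v) j =
    bucket l c j + (v.1 == j)%:R * (bsign v.2 * y a).
Proof.
move=> al; rewrite /bucket big_cons ffunE eqxx mulrA addrC; congr (_ + _).
rewrite big_seq [RHS]big_seq; apply: eq_bigr => b bl; rewrite ffunE.
by have /negbTE -> : b != a by apply: contraNneq al => <-.
Qed.

(** Induction on the coordinates. A new coordinate lands in each bucket with probability [p]. Its
    odd powers average out, so the remaining weights are nonnegative and the induction hypothesis
    applies with one exponent lowered; [prod_add_ge] then passes to independent buckets. *)
Lemma avg_bucket_le (l : seq T) (k : J -> nat) : uniq l ->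
  avg (fun c => \prod_j bucket l c j ^+ k j) <= \prod_j mu p (map y l) (k j).
Proof.
have p0 : 0 <= p by rewrite invr_ge0.
have C0 : (0 < #|{: J * bool}|)%N by rewrite card_prod card_bool muln_gt0 J0.
elim: l k => [|a l IH] k /=.
  move=> _; rewrite (@eq_avg _ _ _ (fun=> \prod_j mu p [::] (k j))).
    by rewrite avg_cst// card_ffun expn_gt0 C0.
  by move=> c; apply: eq_bigr => j _; rewrite /bucket big_nil expr0n.
move=> /andP[al ul]; rewrite (avg_update _ a C0).
(* The exponents left once the new coordinate contributes its i-th power to bucket [j0]. *)
pose kk j0 i j := if j == j0 then (k j0 - i)%N else k j.
have -> : avg (fun c => avg (fun v => \prod_j bucket (a :: l) (update c a v) j ^+ k j))
  = p * \sum_j0 \sum_(i < (k j0).+1 | ~~ odd i)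
      (y a ^+ i *+ 'C(k j0, i)) * avg (fun c => \prod_j bucket l c j ^+ kk j0 i j).
  transitivity (avg (fun c => p * \sum_j0 \sum_(i < (k j0).+1 | ~~ odd i)
      (y a ^+ i *+ 'C(k j0, i)) * \prod_j bucket l c j ^+ kk j0 i j)).
    apply: eq_avg => c; rewrite avg_prod [LHS]/avg -/p; congr (_ * _).
    apply: eq_bigr => j0 _.
    transitivity (avg (fun b => (bucket l c j0 + bsign b * y a) ^+ k j0) *
       \prod_(j | j != j0) bucket l c j ^+ k j).
      rewrite mulrC -avgZ; apply: eq_avg => b.
      rewrite (bigD1 j0)//= bucket_update// (eqxx j0) mul1r mulrC; congr (_ * _).
      apply: eq_bigr => j jj0; rewrite bucket_update//=.
      by rewrite eq_sym (negbTE jj0) mul0r addr0.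
    rewrite avg_sign_exp mulr_suml; apply: eq_bigr => i _.
    rewrite [in RHS](bigD1 j0)//= /kk eqxx mulrA -mulrnAr [_ * (_ *+ _)]mulrC.
    by congr (_ * _); apply: eq_bigr => j /negbTE ->.
  rewrite avgZ; congr (_ * _); rewrite avg_sum; apply: eq_bigr => j0 _.
  by rewrite avg_sum; apply: eq_bigr => i _; rewrite avgZ.
pose m0 := mu p (map y l).
(* The increment from [mu p (map y l)] to [mu p (y a :: map y l)]. *)
pose dl k := p * \sum_(i < k.+1 | (0 < i)%N && ~~ odd i) m0 (k - i)%N * y a ^+ i *+ 'C(k, i).
have dl0 n : 0 <= dl n.
  rewrite mulr_ge0// sumr_ge0// => i /andP[_ ei].
  by rewrite mulrn_wge0// mulr_ge0 ?mu_ge0// even_exp_ge0.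
have m00 n : 0 <= m0 n by exact: mu_ge0.
apply: le_trans (prod_add_ge (fun j => m00 (k j)) (fun j => dl0 (k j))).
apply: (@le_trans _ _ (p * \sum_j0 \sum_(i < (k j0).+1 | ~~ odd i)
      (y a ^+ i *+ 'C(k j0, i)) * \prod_j m0 (kk j0 i j))).
  rewrite ler_wpM2l// ler_sum// => j0 _; rewrite ler_sum// => i ei.
  by rewrite ler_wpM2l ?IH// mulrn_wge0// even_exp_ge0.
rewrite le_eqVlt; apply/orP; left; apply/eqP.
(* The main product is written as its own average over the buckets, to match the terms i = 0 of the
   sums over [j0]. *)
have -> : \prod_j m0 (k j) = p * \sum_(j0 : J) \prod_j m0 (k j).
  by rewrite -[RHS]/(avg (fun=> _)) avg_cst.
rewrite !mulr_sumr -big_split/=; apply: eq_bigr => j0 _.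
rewrite big_mkcond big_ord_recl/= expr0 bin0 mul1r mulrDr; congr (_ * _ + _).
  by apply: eq_bigr => j _; rewrite /kk subn0; case: eqP => // ->.
rewrite -mulrA; congr (_ * _); rewrite mulr_suml big_mkcond/=.
rewrite [in RHS]big_mkcond [in RHS]big_ord_recl/= add0r.
apply: eq_bigr => i _; rewrite /bump/= add1n; case: ifP => //= ei.
rewrite (bigD1 j0)//= {1}/kk eqxx -mulrnAr mulrA [_ * m0 _]mulrC; congr (_ * _).
by apply: eq_bigr => j /negbTE jj; rewrite /kk jj.
Qed.

End Moments.

Lemma le_of_eq d (T : porderType d) (a b : T) : a = b -> (a <= b)%O.
Proof. by move=> ->. Qed.

(** * Exponential generating function of [mu] *)

Section Exponential.
Variable R : realType.
Implicit Types t x : R.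

Lemma sum_exp_coeff_le t n : 0 <= t -> \sum_(i < n) t ^+ i / i`!%:R <= expR t.
Proof.
move=> t0; rewrite /expR -(big_mkord xpredT (fun i => t ^+ i / i`!%:R)).
apply: (@nondecreasing_cvgn_le _ (series (exp_coeff t))).
  by apply: nondecreasing_series => i _ _; exact: exp_coeff_ge0.
exact: is_cvg_series_exp_coeff.
Qed.

(** Since (i + 2)! >= 2 i!, each term is at most x^2 / 2 times a term of the series of exp |x|. *)
Lemma sum_even_exp_coeff_le x b q : `|x| <= b ->
  \sum_(i < q.+1 | (0 < i)%N && ~~ odd i) x ^+ i / i`!%:R <= x ^+ 2 / 2 * expR b.
Proof.
move=> xb; have b0 : 0 <= b by exact: le_trans xb.
have rhs0 : 0 <= x ^+ 2 / 2 * expR b by rewrite mulr_ge0 ?expR_ge0// divr_ge0// sqr_ge0.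
case: q => [|q]; first by rewrite big_mkcond big_ord1.
rewrite big_mkcond !big_ord_recl/= !add0r.
apply: (@le_trans _ _ (\sum_(i < q) x ^+ 2 / 2 * (`|x| ^+ i / i`!%:R))).
  apply: ler_sum => i _; rewrite /bump/= !add1n/= negbK.
  case: ifP => [ei|_]; last first.
    by rewrite mulr_ge0 ?divr_ge0 ?sqr_ge0// exprn_ge0.
  have -> : x ^+ i.+2 = x ^+ 2 * `|x| ^+ i.
    by rewrite -addn2 exprD mulrC -normrX ger0_norm// exprn_even_ge0.
  rewrite -mulrA -[leRHS]mulrA ler_wpM2l ?sqr_ge0// mulrCA ler_wpM2l ?exprn_ge0//.
  rewrite -invfM lef_pV2 ?posrE ?mulr_gt0 ?ltr0n ?fact_gt0//.
  by rewrite -natrM ler_nat !factS mulnA leq_mul2r; apply/orP; right; nia.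
rewrite -mulr_sumr ler_wpM2l ?divr_ge0 ?sqr_ge0//.
by rewrite (le_trans (sum_exp_coeff_le _ _))// ler_expR.
Qed.

Lemma expR_sub1_le x : expR x - 1 <= x * expR x.
Proof.
have := expR_ge1Dx (- x); rewrite -(ler_pM2r (expR_gt0 x)) expRN mulVf ?expR_eq0//.
lra.
Qed.

(** The truncated Cauchy product sums over a triangle contained in the square. *)
Lemma triangle_sum_le (a b : nat -> R) q :
  (forall k, 0 <= a k) -> (forall k, 0 <= b k) ->
  \sum_(k < q.+1) \sum_(i < k.+1) a (k - i)%N * b i <=
  (\sum_(k < q.+1) a k) * \sum_(i < q.+1) b i.
Proof.
move=> a0 b0; rewrite mulr_sumr.
under eq_bigr => k _ do
  rewrite (big_ord_widen_cond _ xpredT (fun i => a (k - i)%N * b i) (ltn_ord k)).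
rewrite (exchange_big_dep xpredT)//= ler_sum// => i _; rewrite -mulr_suml ler_wpM2r//.
rewrite -(big_mkord xpredT a) [leRHS](@big_cat_nat _ _ _ (q.+1 - i)) ?leq_subr//=.
rewrite (_ : \sum_(k < q.+1 | (i < k.+1)%N) _ = \sum_(0 <= k < q.+1 - i) a k).
  by rewrite lerDl sumr_ge0.
transitivity (\sum_(i <= k < q.+1) a (k - i)%N).
  by rewrite big_geq_mkord.
rewrite -{1}[nat_of_ord i]add0n big_addn.
by under eq_bigr do rewrite addnK.
Qed.

(** The recursion for [mu] is a Cauchy product of generating functions, so a coordinate y multiplies
    the truncated sum by at most 1 + p (cosh (th y) - 1), which is in turn bounded by an
    exponential. *)
Lemma mu_egf_le (p th nu : R) l q : 0 <= p -> 0 <= th ->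
  (forall y, y \in l -> `|y| <= nu) ->
  \sum_(k < q.+1) mu p l k * (th ^+ k / k`!%:R) <=
  expR (p * th ^+ 2 / 2 * expR (th * nu) * \sum_(y <- l) y ^+ 2).
Proof.
move=> p0 th0; elim: l => [|y l IH] ynu.
  rewrite big_nil mulr0 expR0 big_ord_recl big1 ?addr0/=.
    by rewrite expr0 fact0 invr1 !mulr1.
  by move=> i _; rewrite mul0r.
have /IH {}IH : forall z, z \in l -> `|z| <= nu by move=> z zl; rewrite ynu// inE zl orbT.
set S := \sum_(k < q.+1) mu p l k * _ in IH.
have S0 : 0 <= S.
  by apply: sumr_ge0 => k _; rewrite mulr_ge0 ?mu_ge0// divr_ge0 ?exprn_ge0.
pose a k := mu p l k * (th ^+ k / k`!%:R).
pose b i := if (0 < i)%N && ~~ odd i then (th * y) ^+ i / i`!%:R else 0.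
have a0 k : 0 <= a k by rewrite mulr_ge0 ?mu_ge0// divr_ge0 ?exprn_ge0.
have b0 k : 0 <= b k.
  by rewrite /b; case: ifP => // /andP[_ ek]; rewrite divr_ge0// even_exp_ge0.
have -> : \sum_(k < q.+1) mu p (y :: l) k * (th ^+ k / k`!%:R) =
   S + p * \sum_(k < q.+1) \sum_(i < k.+1) a (k - i)%N * b i.
  rewrite mulr_sumr -big_split/=; apply: eq_bigr => k _.
  rewrite mulrDl; congr (_ + _); rewrite -mulrA; congr (_ * _).
  rewrite mulr_suml big_mkcond/=; apply: eq_bigr => i _; rewrite /b.
  case: ifP => _; last by rewrite mulr0.
  have ik : (i <= k)%N by rewrite -ltnS.
  rewrite /a exprMn -mulr_natr -[in th ^+ k](subnK ik) exprD -(bin_fact ik) !natrM.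
  have f1 : (i`!%:R : R) != 0 by rewrite pnatr_eq0 -lt0n fact_gt0.
  have f2 : ((k - i)`!%:R : R) != 0 by rewrite pnatr_eq0 -lt0n fact_gt0.
  have f3 : ('C(k, i)%:R : R) != 0 by rewrite pnatr_eq0 -lt0n bin_gt0.
  by field; rewrite f1 f2 f3.
have bs : \sum_(i < q.+1) b i <= th ^+ 2 / 2 * expR (th * nu) * y ^+ 2.
  rewrite /b -big_mkcond/=; apply: le_trans (@sum_even_exp_coeff_le _ (th * nu) _ _) _.
    by rewrite normrM (ger0_norm th0) ler_wpM2l// ynu// mem_head.
  by rewrite exprMn; apply: le_of_eq; ring.
have := triangle_sum_le q a0 b0; rewrite -/S => tri.
rewrite big_cons mulrDr [_ * y ^+ 2 + _]addrC expRD.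
apply: (@le_trans _ _ (S * (1 + p * \sum_(i < q.+1) b i))).
  by rewrite mulrDr mulr1 lerD2l mulrCA ler_wpM2l.
apply: ler_pM => //; first by rewrite addr_ge0// mulr_ge0// sumr_ge0.
apply: le_trans (expR_ge1Dx _); rewrite lerD2l.
apply: le_trans (ler_wpM2l p0 bs) _.
by apply: le_of_eq; ring.
Qed.

(** The term of order 0 is 1, so any other term is at most exp G - 1 <= G exp G. The factor G keeps
    the bound small when G is small. *)
Lemma mu_le (p th nu G : R) l k : 0 <= p -> 0 < th -> (0 < k)%N ->
  (forall y, y \in l -> `|y| <= nu) ->
  p * th ^+ 2 / 2 * expR (th * nu) * \sum_(y <- l) y ^+ 2 = G ->
  mu p l k <= k`!%:R / th ^+ k * (G * expR G).
Proof.
move=> p0 th0 k0 ynu GE; have := mu_egf_le k p0 (ltW th0) ynu; rewrite GE.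
rewrite big_ord_recr/= => h.
have h1 : 1 <= \sum_(i < k) mu p l i * (th ^+ i / i`!%:R).
  case: k k0 {h} => // k _; rewrite big_ord_recl/= mu0 expr0 fact0 divr1 mulr1.
  by rewrite lerDl sumr_ge0// => i _; rewrite mulr_ge0 ?mu_ge0// divr_ge0 ?exprn_ge0// ltW.
have := expR_sub1_le G => h2.
have h3 : mu p l k * (th ^+ k / k`!%:R) <= G * expR G by lra.
have kf : (0 : R) < k`!%:R by rewrite ltr0n fact_gt0.
rewrite mulrC -ler_pdivrMr ?divr_gt0 ?exprn_gt0//.
by rewrite invf_div.
Qed.

End Exponential.

(** * Powers of a sum with dominated mixed moments *)

Section SumPower.
Variables (R : realType) (C I : finType) (T : C -> I -> R) (f : nat -> R).
Hypothesis f0 : forall k, 0 <= f k.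
Hypothesis Tf : forall k : I -> nat,
  avg (fun c => \prod_i T c i ^+ k i) <= \prod_i f (k i).

(* The exponential generating function of the bounds on the moments is
   multiplicative, and its coefficient of order q is at most its value at lam
   divided by lam ^ q. *)
Lemma avg_sum_exp_le (lam : R) q : 0 < lam ->
  avg (fun c => (\sum_i T c i) ^+ q) <=
  q`!%:R / lam ^+ q * (\sum_(k < q.+1) f k * (lam ^+ k / k`!%:R)) ^+ #|I|.
Proof.
move=> lam0; set F := \sum_(k < q.+1) _.
have F0 : 0 <= F.
  by apply: sumr_ge0 => k _; rewrite mulr_ge0// divr_ge0 ?exprn_ge0// ltW.
(* The induction is on the indices still being summed; those outside [r] carry fixed exponents
   [k]. *)
suff H (r : seq I) q' (k : I -> nat) : uniq r -> (q' <= q)%N ->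
    avg (fun c => (\sum_(i <- r) T c i) ^+ q' * \prod_(i | i \notin r) T c i ^+ k i)
    <= q'`!%:R / lam ^+ q' * F ^+ size r * \prod_(i | i \notin r) f (k i).
  have := H (index_enum I) q (fun=> 0%N) (index_enum_uniq I) (leqnn q).
  have nm : (fun i : I => i \notin index_enum I) =1 xpred0.
    by move=> i; rewrite mem_index_enum.
  rewrite (eq_bigl _ _ nm) big_pred0_eq mulr1 cardT enumT.
  by under eq_avg do rewrite (eq_bigl _ _ nm) big_pred0_eq mulr1.
elim: r q' k => [|i0 r IH] q' k.
  move=> _ _; case: q' => [|q'].
    rewrite expr0 fact0 divr1 !mul1r; apply: le_trans _ (Tf k).
    by apply: le_avg => c; rewrite big_nil expr0 mul1r.
  rewrite (@le_trans _ _ 0)//.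
    by rewrite /avg big1 ?mulr0// => c _; rewrite big_nil expr0n mul0r.
  by rewrite mulr1 mulr_ge0 ?prodr_ge0// divr_ge0// exprn_ge0// ltW.
move=> /= /andP[i0r ur] q'q.
pose kk j i := if i == i0 then j else k i.
have split_prod (g : I -> nat -> R) j :
    \prod_(i | i \notin r) g i (kk j i) =
    g i0 j * \prod_(i | i \notin i0 :: r) g i (k i).
  rewrite (bigD1 i0)//= /kk eqxx; congr (_ * _).
  apply: eq_big => i; first by rewrite inE negb_or andbC.
  by case/andP => _ /negbTE ->.
have -> : avg (fun c => (\sum_(i <- i0 :: r) T c i) ^+ q' *
      \prod_(i | i \notin i0 :: r) T c i ^+ k i) =
    \sum_(j < q'.+1) 'C(q', j)%:R * avg (fun c => (\sum_(i <- r) T c i) ^+ (q' - j) *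
      \prod_(i | i \notin r) T c i ^+ kk j i).
  under [RHS]eq_bigr do rewrite -avgZ.
  rewrite -avg_sum; apply: eq_avg => c.
  rewrite big_cons addrC exprDn mulr_suml; apply: eq_bigr => j _.
  rewrite (split_prod (fun i k => T c i ^+ k)) -mulr_natl; ring.
have P0 : 0 <= \prod_(i | i \notin i0 :: r) f (k i) by exact: prodr_ge0.
apply: (@le_trans _ _ (q'`!%:R / lam ^+ q' * F ^+ size r *
   \prod_(i | i \notin i0 :: r) f (k i) * \sum_(j < q'.+1) f j * (lam ^+ j / j`!%:R))).
  rewrite mulr_sumr ler_sum// => j _.
  have jq' : (j <= q')%N by rewrite -ltnS.
  apply: le_trans (ler_wpM2l (ler0n _ _) (IH (q' - j)%N (kk j) ur _)) _.
    exact: leq_trans (leq_subr _ _) q'q.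
  rewrite (split_prod (fun=> f)) -(bin_fact jq') !natrM -[in lam ^+ q'](subnK jq') exprD.
  have f1 : (j`!%:R : R) != 0 by rewrite pnatr_eq0 -lt0n fact_gt0.
  have l0 n : lam ^+ n != 0 by rewrite expf_neq0// gt_eqF.
  apply: le_of_eq; field; rewrite f1 !l0//.
have A0 : 0 <= q'`!%:R / lam ^+ q' * F ^+ size r.
  by rewrite mulr_ge0 ?exprn_ge0// divr_ge0 ?exprn_ge0// ltW.
rewrite exprSr mulrA [leRHS]mulrAC; apply: (ler_wpM2l (mulr_ge0 A0 P0)).
rewrite [leLHS](big_ord_widen q.+1 (fun j => f j * (lam ^+ j / j`!%:R)))//.
rewrite [leLHS]big_mkcond/=.
apply: ler_sum => j _; case: ifP => // _.
by rewrite mulr_ge0// divr_ge0 ?exprn_ge0// ltW.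
Qed.
End SumPower.

(** * Squared norms and orthonormal bases *)

Definition sqnorm (R : pzRingType) n (x : 'cV[R]_n) : R := \sum_i x i 0 ^+ 2.

Lemma sqnormE (R : comPzRingType) n (x : 'cV[R]_n) : sqnorm x = (x^T *m x) 0 0.
Proof. by rewrite mxE; apply: eq_bigr => i _; rewrite mxE expr2. Qed.

Lemma sqnorm_ge0 (R : realDomainType) n (x : 'cV[R]_n) : 0 <= sqnorm x.
Proof. by apply: sumr_ge0 => i _; exact: sqr_ge0. Qed.

Lemma sqnorm_eq0 (R : realDomainType) n (x : 'cV[R]_n) : sqnorm x = 0 -> x = 0.
Proof.
move/psumr_eq0P => H; apply/matrixP => i j; rewrite ord1 mxE.
by apply/eqP; rewrite -sqrf_eq0 H// => k _; exact: sqr_ge0.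
Qed.

Lemma sqnorm_isometry (R : comPzRingType) m n (U : 'M[R]_(m, n)) x :
  U^T *m U = 1%:M -> sqnorm (U *m x) = sqnorm x.
Proof.
by move=> UU; rewrite !sqnormE trmx_mul mulmxA -[_ *m _ *m U]mulmxA UU mulmx1.
Qed.

(** Column by column: the component orthogonal to the basis built so far either vanishes or, once
    normalised, is a new basis vector. *)
Lemma gram_schmidt (R : rcfType) n d (A : 'M[R]_(n, d)) :
  exists r (U : 'M[R]_(n, r)) (C : 'M[R]_(r, d)),
    [/\ U^T *m U = 1%:M, A = U *m C & r = \rank A].
Proof.
(* The equation [U = A *m W] places the columns of [U] in the column space of [A], which bounds
   their number by the rank. *)
suff [r [U [C [W [UU AUC UAW]]]]] : exists r (U : 'M[R]_(n, r)) (C : 'M[R]_(r, d)) W,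
    [/\ U^T *m U = 1%:M, A = U *m C & U = A *m W].
  exists r, U, C; split => //; apply/eqP; rewrite eqn_leq andbC.
  rewrite {1}AUC (leq_trans (mxrankM_maxl _ _) (rank_leq_col _))/=.
  rewrite -{1}(mxrank1 R r) -UU (leq_trans (mxrankM_maxr _ _))//.
  by rewrite UAW mxrankM_maxl.
elim: d A => [|d IH] A.
  exists 0%N, 0, 0, 0; split; rewrite ?mulmx0 //.
  - by apply/matrixP => -[].
  - by apply/matrixP => i [].
suff H (A' : 'M[R]_(n, 1 + d)) : exists r (U : 'M[R]_(n, r)) (C : 'M[R]_(r, 1 + d)) W,
    [/\ U^T *m U = 1%:M, A' = U *m C & U = A' *m W].
  exact: (H A).
move: A' {A} => A; pose a : 'cV[R]_n := lsubmx A; pose B : 'M[R]_(n, d) := rsubmx A.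
have [r [U [C [W [UU BUC UBW]]]]] := IH B.
have AE : A = row_mx a B by rewrite /a /B hsubmxK.
pose e := a - U *m (U^T *m a).
have aE : a = e + U *m (U^T *m a) by rewrite subrK.
have Ue : U^T *m e = 0 by rewrite mulmxBr !mulmxA UU mul1mx subrr.
have [e0|e0] := eqVneq e 0.
  exists r, U, (row_mx (U^T *m a) C), (col_mx (0 : 'M[R]_(1, r)) W); split => //.
    by rewrite mul_mx_row AE -BUC; congr row_mx; rewrite {1}aE e0 add0r.
  by rewrite AE mul_row_col mulmx0 add0r.
pose nu := Num.sqrt (sqnorm e).
have nu2 : nu ^+ 2 = sqnorm e by rewrite sqr_sqrtr// sqnorm_ge0.
have nu0 : nu != 0.
  by apply: contra_neq e0 => nu0; apply: sqnorm_eq0; rewrite -nu2 nu0 expr0n.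
have eTe : e^T *m e = (nu ^+ 2)%:M by rewrite [LHS]mx11_scalar -sqnormE nu2.
pose u := nu^-1 *: e.
have Uu : U^T *m u = 0 by rewrite -scalemxAr Ue scaler0.
have uu : u^T *m u = 1%:M.
  rewrite [LHS]mx11_scalar -sqnormE /sqnorm.
  under eq_bigr do rewrite mxE exprMn.
  by rewrite -mulr_sumr -/(sqnorm e) -nu2 -exprMn mulVf// expr1n.
exists (1 + r)%N, (row_mx u U), (block_mx nu%:M 0 (U^T *m a) C),
  (row_mx (col_mx (nu^-1)%:M (- nu^-1 *: (W *m (U^T *m a)))) (col_mx 0 W)).
split.
- rewrite tr_row_mx mul_col_row uu Uu UU.
  have -> : u^T *m U = 0 by rewrite -[U]trmxK -trmx_mul Uu trmx0.
  by rewrite -scalar_mx_block.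
- rewrite mul_row_block mulmx0 add0r -BUC AE; congr row_mx.
  by rewrite mul_mx_scalar /u scalerA mulfV// scale1r -aE.
- rewrite AE mul_mx_row !mul_row_col mulmx0 add0r -UBW; congr row_mx.
  rewrite mul_mx_scalar -scalemxAr [B *m _]mulmxA -UBW scaleNr -scalerBr.
  by [].
Qed.

(** * Quadratic forms controlled on an integer grid *)

Section QuadraticForm.
Variables (R : realType) (r : nat) (M : 'M[R]_r).
Definition qform (x : 'cV[R]_r) : R := \sum_i \sum_j x i 0 * M i j * x j 0.

Lemma qformZ a x : qform (a *: x) = a ^+ 2 * qform x.
Proof.
rewrite /qform mulr_sumr; apply: eq_bigr => i _; rewrite mulr_sumr.
by apply: eq_bigr => j _; rewrite !mxE; ring.
Qed.

Lemma sqnormZ a (x : 'cV[R]_r) : sqnorm (a *: x) = a ^+ 2 * sqnorm x.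
Proof. by rewrite /sqnorm mulr_sumr; apply: eq_bigr => i _; rewrite mxE exprMn. Qed.

(** The cross term is recovered by polarisation at 4 e rather than e, because z and 4 e have
    comparable norms when |z|^2 <= 16 r and |e|^2 <= r. *)
Lemma qform_polar z e :
  qform (z + e) = qform z + qform e + (qform (z + 4 *: e) - qform (z - 4 *: e)) / 8.
Proof.
rewrite /qform -sumrB mulr_suml -!big_split/=; apply: eq_bigr => i _.
rewrite -sumrB mulr_suml -!big_split/=; apply: eq_bigr => j _.
by rewrite !mxE; field.
Qed.

Lemma sqnorm_parallelogram (z e : 'cV[R]_r) :
  sqnorm (z + 4 *: e) + sqnorm (z - 4 *: e) = 2 * sqnorm z + 32 * sqnorm e.
Proof.
rewrite /sqnorm !mulr_sumr -!big_split/=; apply: eq_bigr => i _.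
by rewrite !mxE; ring.
Qed.

Lemma qform_bounded : exists2 b, 0 <= b & forall x, `|qform x| <= b * sqnorm x.
Proof.
exists (\sum_i \sum_j `|M i j|) => [|x].
  by apply: sumr_ge0 => i _; apply: sumr_ge0.
rewrite (le_trans (ler_norm_sum _ _ _))// mulr_suml ler_sum// => i _.
rewrite (le_trans (ler_norm_sum _ _ _))// mulr_suml ler_sum// => j _.
rewrite mulrAC normrM mulrC ler_wpM2l//.
have xle k : x k 0 ^+ 2 <= sqnorm x.
  by rewrite /sqnorm (bigD1 k)//= lerDl sumr_ge0// => ? _; exact: sqr_ge0.
have := xle i; have := xle j; rewrite normrM -[x i 0 ^+ 2]real_normK ?num_real//.
rewrite -[x j 0 ^+ 2]real_normK ?num_real//.
set a := `|_|; set b := `|_|; have := sqr_ge0 (a - b); nra.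
Qed.

(* The best constant b with |qform x| <= b |x|^2 satisfies b <= a + 9/16 b. *)
Lemma qform_net (N : set 'cV[R]_r) (a : R) : (0 < r)%N -> 0 <= a ->
  (forall x, sqnorm x = 16 * r%:R ->
     exists z, [/\ N z, sqnorm z <= 16 * r%:R & sqnorm (x - z) <= r%:R]) ->
  (forall z, N z -> `|qform z| <= a * sqnorm z) ->
  forall x, `|qform x| <= 3 * a * sqnorm x.
Proof.
move=> r0 a0 Nnet Na.
pose valid : set R := [set b | 0 <= b /\ forall x, `|qform x| <= b * sqnorm x].
have rr : (0 : R) < r%:R by rewrite ltr0n.
(* For |x|^2 = 16 r and x = z + e, the three terms of [qform_polar] are at most 16 a r, b r and 64 b
   r / 8, in total 16 r (a + 9/16 b). *)
have step b : valid b -> valid (a + 9 / 16 * b).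
  case=> b0 bv; split; first by lra.
  have H16 x : sqnorm x = 16 * r%:R -> `|qform x| <= (a + 9 / 16 * b) * sqnorm x.
    move=> xr; have [z [Nz z16 ez]] := Nnet x xr.
    have xE : x = z + (x - z) by rewrite addrC subrK.
    rewrite xr {1}xE qform_polar; move: (x - z) ez => e ez.
    have h1 := Na z Nz; have h2 := bv e.
    have h3 := bv (z + 4 *: e); have h4 := bv (z - 4 *: e).
    have nE := sqnorm_parallelogram z e.
    have h9 : a * sqnorm z <= a * (16 * r%:R) by rewrite ler_wpM2l.
    have h10 : b * sqnorm e <= b * r%:R by rewrite ler_wpM2l.
    have h11 : b * sqnorm (z + 4 *: e) + b * sqnorm (z - 4 *: e) <= b * (64 * r%:R).
      by rewrite -mulrDr ler_wpM2l// nE; lra.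
    move: h1 h2 h3 h4; rewrite !ler_norml.
    move=> /andP[h1 h1'] /andP[h2 h2'] /andP[h3 h3'] /andP[h4 h4'].
    by apply/andP; split; lra.
  move=> x; have [/sqnorm_eq0 x0|x0] := eqVneq (sqnorm x) 0.
    by rewrite x0 -(scale0r 0) qformZ sqnormZ expr0n !mul0r mulr0 normr0.
  have xp : 0 < sqnorm x by rewrite lt_def x0 sqnorm_ge0.
  pose c := Num.sqrt (16 * r%:R / sqnorm x).
  have c2 : c ^+ 2 = 16 * r%:R / sqnorm x by rewrite sqr_sqrtr// divr_ge0// ?ltW//; lra.
  have := H16 (c *: x); rewrite qformZ sqnormZ c2 divfK// => /(_ erefl).
  have cp : 0 < 16 * r%:R / sqnorm x by rewrite divr_gt0//; lra.
  rewrite normrM gtr0_norm// => h; rewrite -(ler_pM2l cp) (le_trans h)//.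
  by rewrite [leRHS]mulrCA divfK.
have [b0 b00 b0v] := qform_bounded.
have hi : has_inf valid by split; [exists b0 | exists 0 => b []].
pose bi := inf valid.
have biv : valid bi.
  split; first by apply: lb_le_inf; [exists b0 | move=> b []].
  move=> x; have [/sqnorm_eq0 x0|x0] := eqVneq (sqnorm x) 0.
    by rewrite x0 -(scale0r 0) qformZ sqnormZ expr0n !mul0r mulr0 normr0.
  have xp : 0 < sqnorm x by rewrite lt_def x0 sqnorm_ge0.
  rewrite -ler_pdivrMr//; apply: lb_le_inf; first by exists b0.
  by move=> b [_ bv]; rewrite /= ler_pdivrMr.
(* The improved constant is valid, hence not below the infimum: bi <= a + 9/16 bi, so bi <= 16/7 a
   <= 3 a. *)
have := ge_inf hi.2 (step _ biv); rewrite -/bi => hb x.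
apply: le_trans (biv.2 x) _; rewrite ler_wpM2r ?sqnorm_ge0//.
have := biv.1; lra.
Qed.

(** Integer points are coded by signs and magnitudes. A zero coordinate has two codes, so counting
    codes overestimates the points. *)
Definition grid_point (f : {ffun 'I_r -> bool * 'I_(16 * r).+1}) : 'cV[R]_r :=
  \col_i (bsign R (f i).1 * (f i).2%:R).

(** An l1 constraint: as k <= k^2 for integers, it holds at every integer point with |z|^2 <= 16 r,
    and it is easy to count. *)
Definition in_grid (f : {ffun 'I_r -> bool * 'I_(16 * r).+1}) : bool :=
  (\sum_i (f i).2 <= 16 * r)%N.

Lemma sqnorm_grid_point f : sqnorm (grid_point f) = \sum_i (f i).2%:R ^+ 2.
Proof.
apply: eq_bigr => i _; rewrite mxE exprMn.
by rewrite /bsign -exprM mulnC exprM sqrrN expr1n expr1n mul1r.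
Qed.

(** Truncating the coordinates towards zero does not lengthen the vector and moves each coordinate
    by at most 1. *)
Lemma grid_rounding (x : 'cV[R]_r) : sqnorm x = 16 * r%:R ->
  exists f, [/\ in_grid f, sqnorm (grid_point f) <= 16 * r%:R &
               sqnorm (x - grid_point f) <= r%:R].
Proof.
move=> x16.
pose t i := Num.truncn `|x i 0|.
have tr i : (t i)%:R <= `|x i 0| < (t i)%:R + 1.
  by rewrite natr1; exact: truncn_itv.
have xle i : (t i)%:R ^+ 2 <= x i 0 ^+ 2.
  by rewrite -[X in _ <= X]real_normK ?num_real// lerXn2r ?nnegrE//; case/andP: (tr i).
have nn (n : nat) : (n%:R : R) <= n%:R ^+ 2.
  by rewrite -natrX ler_nat; case: n => // n; rewrite expnS expn1 leq_pmulr.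
have sle : \sum_i (t i)%:R ^+ 2 <= (16 * r)%:R :> R.
  by rewrite natrM -x16 ler_sum.
have kle i : (t i < (16 * r).+1)%N.
  rewrite ltnS -(ler_nat R) (le_trans (nn _))// (le_trans _ sle)//.
  by rewrite (bigD1 i)//= lerDl sumr_ge0// => ? _; exact: sqr_ge0.
pose f := [ffun i => (x i 0 < 0, Ordinal (kle i))].
exists f; split.
- rewrite /in_grid -(ler_nat R) natr_sum (le_trans _ sle)// ler_sum// => i _.
  by rewrite ffunE nn.
- rewrite sqnorm_grid_point -natrM (le_trans _ sle)//.
  by under eq_bigr do rewrite ffunE.
- rewrite /sqnorm -[X in _ <= X%:R]card_ord -sumr_const ler_sum// => i _.
  rewrite !mxE ffunE/= -real_normK ?num_real// expr_le1//.
  have := tr i; case: (ltrP (x i 0) 0) => x0 /andP[].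
    rewrite (ltr0_norm x0) /bsign expr1 => *; rewrite ler_norml; apply/andP; split; lra.
  rewrite (ger0_norm x0) /bsign expr0 => *; rewrite ler_norml; apply/andP; split; lra.
Qed.

(** With the weight 2^(-k) on a coordinate of magnitude k, a grid point weighs at least 2^(-16 r),
    while all points together weigh at most 4^r. *)
Lemma card_grid : (#|[set f | in_grid f]%SET| <= 2 ^ (18 * r))%N.
Proof.
pose w (c : bool * 'I_(16 * r).+1) : R := 2^-1 ^+ c.2.
have w0 c : 0 <= w c by rewrite exprn_ge0// invr_ge0.
have sw : \sum_c w c <= 4.
  have -> : \sum_c w c = \sum_(b : bool) \sum_k w (b, k).
    by rewrite pair_big; apply: eq_bigr => -[].
  rewrite big_bool/=.
  have H n : \sum_(k < n) 2^-1 ^+ k <= 2 :> R.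
    have -> : \sum_(k < n) 2^-1 ^+ k = 2 - 2 * 2^-1 ^+ n :> R.
      elim: n => [|n IH]; first by rewrite big_ord0 expr0; ring.
      by rewrite big_ord_recr/= IH exprS; field.
    have h0 : 0 <= 2^-1 ^+ n :> R by rewrite exprn_ge0// invr_ge0.
    by lra.
  have := H (16 * r).+1; rewrite /w /=; lra.
have : 2^-1 ^+ (16 * r) * #|[set f | in_grid f]%SET|%:R <= 4 ^+ r :> R.
  apply: (@le_trans _ _ (\sum_(f : {ffun 'I_r -> bool * 'I_(16 * r).+1}) \prod_i w (f i))).
    rewrite -sum1_card natr_sum mulr_sumr big_mkcond/= ler_sum// => f _.
    rewrite inE; case: ifP => fg; last exact: prodr_ge0.
    by rewrite mulr1 /w prodrXr; apply: ler_wiXn2l; [lra|lra|exact: fg].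
  rewrite -(bigA_distr_bigA (fun _ => w)) prodr_const card_ord.
  by rewrite lerXn2r// nnegrE// sumr_ge0.
rewrite exprVn ler_pdivrMl ?exprn_gt0// -(ler_nat R) => /le_trans; apply.
have -> : 4 = 2 ^+ 2 :> R by ring.
rewrite natrX -exprM -exprD.
by rewrite (_ : 18 * r = 16 * r + 2 * r)%N//; lia.
Qed.

End QuadraticForm.

(** * Decoupling by a random colouring *)

Section Decoupling.
Variables (R : realType) (T : finType) (m : nat).

Definition hash_err (y : T -> R) (c : {ffun T -> 'I_m} * {ffun T -> bool}) : R :=
  \sum_i (\sum_(a | c.1 a == i) bsign R (c.2 a) * y a) ^+ 2 - \sum_a y a ^+ 2.

Lemma hash_errZ (k : R) y c : hash_err (fun a => k * y a) c = k ^+ 2 * hash_err y c.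
Proof.
rewrite /hash_err mulrBr !mulr_sumr; congr (_ - _); apply: eq_bigr => i _.
  by rewrite -exprMn mulr_sumr; congr (_ ^+ 2); apply: eq_bigr => a _; rewrite mulrCA.
by rewrite exprMn.
Qed.

Lemma avg_cut (a b : T) :
  avg (fun t : {ffun T -> bool} => (t a && ~~ t b)%:R) = (a != b)%:R / 4 :> R.
Proof.
have [->|ab] /= := eqVneq a b.
  by rewrite mul0r /avg big1 ?mulr0// => t _; rewrite andbN.
rewrite (avg_update _ a) ?card_bool//.
transitivity (avg (fun t : {ffun T -> bool} => (~~ t b)%:R / 2 : R)).
  apply: eq_avg => t; rewrite avg_bool !ffunE eqxx eq_sym (negbTE ab) /=.
  by rewrite addr0.
rewrite (avg_update _ b) ?card_bool//.
rewrite (eq_avg (G := fun=> 1 / 4)) => [|t].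
  by rewrite avg_cst// card_ffun card_bool expn_gt0.
by rewrite avg_bool !ffunE eqxx /=; field.
Qed.

(** Bucket and colour together name one of 2m buckets, so that a uniform hash with a uniform
    colouring becomes a uniform hash into those. *)
Definition merge (c : ({ffun T -> 'I_m} * {ffun T -> bool}) * {ffun T -> bool}) :
    {ffun T -> ('I_m * bool) * bool} :=
  [ffun a => ((c.1.1 a, c.2 a), c.1.2 a)].

Lemma merge_bij : bijective merge.
Proof.
exists (fun c : {ffun T -> ('I_m * bool) * bool} => 
  (([ffun a => (c a).1.1] : {ffun T -> 'I_m},
  [ffun a => (c a).2] : {ffun T -> bool}), [ffun a => (c a).1.2] : {ffun T -> bool})).
  by case=> -[h g] t; congr (_, _, _); apply/ffunP => a; rewrite !ffunE.
by move=> c; apply/ffunP => a; rewrite !ffunE; case: (c a) => -[].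
Qed.

Definition cross (y : T -> R) (c : {ffun T -> ('I_m * bool) * bool}) (i : 'I_m) : R :=
  bucket y (index_enum T) c (i, true) * bucket y (index_enum T) c (i, false).

(** An ordered pair of distinct coordinates receives the colours true and false with probability
    1/4, a diagonal pair never. The diagonal of the squared bucket sums is exactly the sum of the
    y_a^2 that is subtracted. *)
Lemma hash_err_cross y c :
  hash_err y c = 4 * avg (fun t => \sum_i cross y (merge (c, t)) i).
Proof.
case: c => h g; pose u a i := (h a == i)%:R * (bsign R (g a) * y a).
have crossE t i : cross y (merge (h, g, t)) i =
    \sum_a \sum_b u a i * u b i * (t a && ~~ t b)%:R.
  rewrite /cross /bucket big_distrlr; apply: eq_bigr => a _; apply: eq_bigr => b _.
  rewrite !ffunE /= !xpair_eqE eqb_id eqbF_neg /u.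
  case: (t a); case: (t b); rewrite /= ?andbF ?andbT ?mulr0n; ring.
have -> : avg (fun t => \sum_i cross y (merge (h, g, t)) i) =
    \sum_i \sum_a \sum_b u a i * u b i * ((a != b)%:R / 4).
  rewrite avg_sum; apply: eq_bigr => i _.
  under eq_avg do rewrite crossE.
  rewrite avg_sum; apply: eq_bigr => a _; rewrite avg_sum; apply: eq_bigr => b _.
  by rewrite avgZ avg_cut.
have yE : \sum_a y a ^+ 2 = \sum_i \sum_a \sum_b u a i * u b i * (a == b)%:R.
  rewrite exchange_big; apply: eq_bigr => a _.
  rewrite (bigD1 (h a))//= (bigD1 a)//= !big1 ?addr0.
  - rewrite /u !eqxx /bsign; case: (g a); rewrite ?expr1 ?expr0 ?mulr1n; ring.
  - move=> i hi; rewrite big1// => b _.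
    by rewrite /u eq_sym (negbTE hi) !mul0r.
  - by move=> b; rewrite eq_sym => /negbTE ->; rewrite mulr0.
rewrite /hash_err/= yE mulr_sumr -sumrB; apply: eq_bigr => i _.
have -> : \sum_(a | h a == i) bsign R (g a) * y a = \sum_a u a i.
  rewrite big_mkcond; apply: eq_bigr => a _; rewrite /u.
  by case: eqP => _ /=; rewrite ?mulr0n ?mulr1n; ring.
rewrite expr2 big_distrlr/= mulr_sumr -sumrB; apply: eq_bigr => a _.
rewrite mulr_sumr -sumrB; apply: eq_bigr => b _.
by case: eqP => _ /=; rewrite ?mulr0n ?mulr1n; field.
Qed.

(** Jensen's inequality moves the power inside the average over colourings. Each bucket then
    contributes the product of its two coloured parts, whence the squares of [mu]. *)
Lemma avg_hash_err_le y e lam : (0 < m)%N -> 0 < lam ->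
  avg (fun c => hash_err y c ^+ (2 ^ e)) <=
  4 ^+ (2 ^ e) * ((2 ^ e)`!%:R / lam ^+ (2 ^ e) *
   (\sum_(k < (2 ^ e).+1) mu ((m * 2)%:R^-1) (map y (index_enum T)) k ^+ 2 *
      (lam ^+ k / k`!%:R)) ^+ m).
Proof.
move=> m0 lam0.
apply: (@le_trans _ _ (4 ^+ (2 ^ e) *
   avg (fun c => (\sum_i cross y c i) ^+ (2 ^ e)))).
  rewrite -(avg_bij (fun c => (\sum_i cross y c i) ^+ (2 ^ e)) merge_bij).
  rewrite [X in _ <= _ * X]avg_prod -avgZ; apply: le_avg => c.
  by rewrite hash_err_cross exprMn ler_wpM2l ?exprn_ge0// avg_pow2_le.
rewrite ler_wpM2l ?exprn_ge0//.
have cJ : #|{: 'I_m * bool}| = (m * 2)%N by rewrite card_prod card_ord card_bool.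
have := @avg_sum_exp_le R _ _ (cross y)
  (fun k => mu ((m * 2)%:R^-1) (map y (index_enum T)) k ^+ 2).
rewrite card_ord; apply => // [k|k]; first exact: sqr_ge0.
have J0 : (0 < #|{: 'I_m * bool}|)%N by rewrite cJ muln_gt0 m0.
have := avg_bucket_le y J0 (fun j => k j.1) (index_enum_uniq T).
have pairE (F : 'I_m -> bool -> R) : \prod_j F j.1 j.2 = \prod_i (F i true * F i false).
  by rewrite -(pair_bigA _ F); apply: eq_bigr => i _; rewrite big_bool.
rewrite cJ (pairE (fun i _ => mu _ _ (k i))) => h; apply: le_trans h.
apply: le_of_eq; apply: eq_avg => c.
rewrite (eq_bigr (fun j => bucket y (index_enum T) c (j.1, j.2) ^+ k j.1)); last by case.
rewrite (pairE (fun i b => bucket y (index_enum T) c (i, b) ^+ k i)).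
by apply: eq_bigr => i _; rewrite exprMn.
Qed.

End Decoupling.

(** * Hoeffding's inequality for random signs *)

Section Hoeffding.
Variable R : realType.

Lemma avg_ffun_prod (I C : finType) (F : I -> C -> R) :
  avg (fun f : {ffun I -> C} => \prod_a F a (f a)) = \prod_a avg (F a).
Proof.
rewrite /avg big_split/= prodr_const card_ffun natrX exprVn; congr (_ * _).
by rewrite bigA_distr_bigA.
Qed.

(** The constant 2 in the exponent, larger than the optimal 1/2, allows elementary bounds for x >=
    0: exp x <= 1 / (1 - x) if x^2 <= 1/2, and x <= 2 x^2 otherwise. *)
Lemma cosh_le (x : R) : expR x + expR (- x) <= 2 * expR (2 * x ^+ 2).
Proof.
wlog x0 : x / 0 <= x.
  move=> H; have [/H//|/ltW x0] := leP 0 x.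
  by have := H (- x); rewrite oppr_ge0 sqrrN opprK addrC; exact.
have [x1|x1] := leP (x ^+ 2) (1 / 2).
  have xl1 : x < 1.
    by rewrite ltNge; apply/negP => h; have : 1 <= x ^+ 2 by [rewrite exprn_ege1]; lra.
  have e1 := expR_ge1Dx (- x); have e2 := expR_ge1Dx x.
  have e3 := expR_ge1Dx (2 * x ^+ 2).
  have h1 : expR x <= (1 - x)^-1.
    by rewrite -[x in expR x]opprK expRN lef_pV2 ?posrE ?expR_gt0//; lra.
  have h2 : expR (- x) <= (1 + x)^-1.
    by rewrite expRN lef_pV2 ?posrE ?expR_gt0//; lra.
  have h3 : (1 - x)^-1 + (1 + x)^-1 = 2 * (1 - x ^+ 2)^-1.
    by field; rewrite !gt_eqF//; nra.
  have h4 : (1 - x ^+ 2)^-1 <= 1 + 2 * x ^+ 2.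
    by rewrite -[leLHS]mul1r ler_pdivrMr; nra.
  lra.
have h1 : expR (- x) <= expR x by rewrite ler_expR; lra.
have h2 : expR x <= expR (2 * x ^+ 2) by rewrite ler_expR; nra.
lra.
Qed.

Lemma hoeffding (I : finType) (c : I -> R) (V t : R) : 0 < V -> 0 < t ->
  \sum_a c a ^+ 2 <= V ->
  avg (fun g : {ffun I -> bool} => (t < `|\sum_a bsign R (g a) * c a|)%R%:R) <=
  2 * expR (- t ^+ 2 / (8 * V)).
Proof.
(* This minimises the Chernoff exponent - th t + 2 th^2 V; the minimum is - t^2 / (8 V). *)
move=> V0 t0 cV; pose th := t / (4 * V).
have th0 : 0 < th by rewrite divr_gt0// mulr_gt0.
have mgf (a : R) : a ^+ 2 = th ^+ 2 ->
    avg (fun g : {ffun I -> bool} => expR (a * \sum_i bsign R (g i) * c i)) <=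
    expR (2 * th ^+ 2 * V).
  move=> a2.
  under eq_avg do rewrite mulr_sumr expR_sum.
  rewrite (avg_ffun_prod (fun i b => expR (a * (bsign R b * c i)))).
  apply: (@le_trans _ _ (\prod_i expR (2 * th ^+ 2 * c i ^+ 2))).
    apply: ler_prod => i _; rewrite /avg mulr_ge0 ?invr_ge0//=; last first.
      by rewrite sumr_ge0// => b _; exact: expR_ge0.
    rewrite -/(avg _) avg_bool /bsign expr0 expr1 mul1r mulN1r mulrN addrC.
    have := cosh_le (a * c i); rewrite exprMn a2 mulrA; lra.
  by rewrite -expR_sum -mulr_sumr ler_expR ler_wpM2l// mulr_ge0// sqr_ge0.
apply: (@le_trans _ _ (avg (fun g : {ffun I -> bool} => expR (- (th * t)) *
    expR (th * \sum_i bsign R (g i) * c i) +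
    expR (- (th * t)) * expR (- th * \sum_i bsign R (g i) * c i)))).
  apply: le_avg => g; set S := \sum_a _.
  have p1 := expR_ge0 (- (th * t)); have p2 := expR_ge0 (th * S).
  have p3 := expR_ge0 (- th * S).
  case: ltP => tS; last by rewrite addr_ge0// mulr_ge0.
  rewrite -!expRD; have [S0|S0] := leP 0 S.
    rewrite (ger0_norm S0) in tS; rewrite (@le_trans _ _ (expR (- (th * t) + th * S)))//.
      by rewrite -expR0 ler_expR addrC subr_ge0 ler_wpM2l// ltW.
    by rewrite lerDl expR_ge0.
  rewrite (ltr0_norm S0) in tS; rewrite (@le_trans _ _ (expR (- (th * t) + - th * S)))//.
    by rewrite -expR0 ler_expR addrC mulNr -mulrN subr_ge0 ler_wpM2l// ltW.
  by rewrite lerDr expR_ge0.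
have avgD (F G : {ffun I -> bool} -> R) : avg (fun g => F g + G g) = avg F + avg G.
  by rewrite /avg big_split mulrDr.
rewrite avgD !avgZ.
have e0 := expR_ge0 (- (th * t)).
have m1 := ler_wpM2l e0 (mgf th erefl).
have m2 := ler_wpM2l e0 (mgf (- th) (sqrrN th)).
have -> : 2 * expR (- t ^+ 2 / (8 * V)) =
    expR (- (th * t)) * expR (2 * th ^+ 2 * V) + expR (- (th * t)) * expR (2 * th ^+ 2 * V).
  rewrite -!expRD -mulr2n mulr_natl; congr (expR _ *+ 2).
  by rewrite /th; field; rewrite gt_eqF.
exact: lerD.
Qed.
End Hoeffding.

(** * Tail bound for hashing flat vectors *)

Section HashTail.
Variable R : realType.

(* With lam = hash_B q / eps, the moment of order q yields the tail bound
   (12 e q / (eps lam)) ^ q = exp (- 5 q). *)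
Definition hash_B : R := 12 * expR 6.
Definition hash_C2 : R := (256 * hash_B)^-1.

Lemma hash_B_gt0 : 0 < hash_B.
Proof. by rewrite mulr_gt0// expR_gt0. Qed.

Lemma hash_C2_gt0 : 0 < hash_C2.
Proof. by rewrite invr_gt0 mulr_gt0// hash_B_gt0. Qed.

(** In [hash_mu_le] the product enters as 128 B C2 = 1/2 in the bounds on th nu and as 32 B C2 = 1/8
    in those on G. *)
Lemma hash_BC2 : hash_B * hash_C2 = 256^-1.
Proof. by rewrite /hash_C2; field; rewrite gt_eqF// hash_B_gt0. Qed.

Lemma hash_C2_lt1 : hash_C2 < 1.
Proof.
have := hash_BC2; have := expR_ge1Dx (6 : R); have := hash_C2_gt0.
rewrite /hash_B; nra.
Qed.

Lemma expR1_le4 : expR 1 <= 4 :> R.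
Proof.
have h := expR_ge1Dx (- (2^-1) : R).
have h2 : expR (2^-1) <= 2 :> R.
  by rewrite -[2^-1]opprK expRN -[leRHS]invrK lef_pV2 ?posrE ?expR_gt0//; lra.
have -> : (1 : R) = 2^-1 + 2^-1 by lra.
rewrite expRD; have := expR_ge0 (2^-1 : R); nra.
Qed.

Lemma fact_le_exp k : k`!%:R <= k%:R ^+ k :> R.
Proof.
rewrite -natrX ler_nat; elim: k => // k IH.
rewrite factS expnS leq_mul2l /= (leq_trans IH)//.
by case: k {IH} => // k; rewrite leq_exp2r.
Qed.

(* The parameter th ^ 2 = 128 lam k of the generating function depends on k; the
   hypotheses on nu bound exp (th nu) by E / (C2 eps), which makes the exponent
   G at most k / 4, and by sqrt (E exp k), which makes G ^ 2 of order q / m. *)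
Lemma hash_mu_le (eps L E nu : R) (q m k : nat) (ys : seq R) :
  0 < eps < 1 -> 0 < L -> L <= q%:R <= 2 * L -> 1 <= E -> (0 < m)%N ->
  E * hash_C2 ^- 2 * eps ^- 2 * L <= m%:R ->
  0 <= nu ->
  4 * nu ^+ 2 <= hash_C2 * eps * (ln (E / (hash_C2 * eps)) / L) ^+ 2 ->
  4 * nu ^+ 2 <= hash_C2 * eps * (ln E / L) ->
  (forall y, y \in ys -> `|y| <= nu) -> \sum_(y <- ys) y ^+ 2 = 1 ->
  (0 < k <= q)%N ->
  mu ((m * 2)%:R^-1) ys k ^+ 2 * ((hash_B * q%:R / eps) ^+ k / k`!%:R) <=
  2^-1 ^+ k * (q%:R / m%:R).
Proof.
move=> /andP[e0 e1] L0 /andP[Lq qL] E1 m0 mE nu0 nuA nuB ysnu ys1 /andP[k0 kq].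
have B0 := hash_B_gt0; have C0 := hash_C2_gt0; have BC := hash_BC2; have C1 := hash_C2_lt1.
set B := hash_B in B0 BC *; set C2 := hash_C2 in C0 C1 BC mE nuA nuB *.
clearbody B C2.
have mR : (0 : R) < m%:R by rewrite ltr0n.
have kR : (0 : R) < k%:R by rewrite ltr0n.
have kqR : (k%:R : R) <= q%:R by rewrite ler_nat.
have qR : (0 : R) < q%:R by exact: lt_le_trans kqR.
have E0 : 0 < E by lra.
have Ce0 : 0 < C2 * eps by rewrite mulr_gt0.
have ECe : 1 <= E / (C2 * eps).
  by rewrite ler_pdivlMr// mul1r (le_trans _ E1)// -[leRHS]mulr1 ler_pM// ltW.
set l1 := ln (E / (C2 * eps)) in nuA; set l2 := ln E in nuB.
have l10 : 0 <= l1 by exact: ln_ge0.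
have l20 : 0 <= l2 by exact: ln_ge0.
set lam := B * q%:R / eps.
have lamE : lam = B * q%:R / eps by [].
have lam0 : 0 < lam by rewrite divr_gt0// mulr_gt0.
clearbody lam.
pose th := Num.sqrt (128 * lam * k%:R).
have th2 : th ^+ 2 = 128 * lam * k%:R. by rewrite sqr_sqrtr// !mulr_ge0// ltW.
have th0 : 0 < th by rewrite sqrtr_gt0 !mulr_gt0.
have th00 := ltW th0; have lam00 := ltW lam0; have B00 := ltW B0; have C00 := ltW C0.
have k00 := ltW kR; have q00 := ltW qR; have m00 := ltW mR; have e00 := ltW e0.
have L00 := ltW L0; have E00 := ltW E0; have Ce00 := ltW Ce0.
have th_nu2 : (th * nu) ^+ 2 * 4 = 128 * (B * q%:R * k%:R) * (4 * nu ^+ 2 / eps).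
  by rewrite exprMn th2 lamE; field; rewrite gt_eqF.
have qk0 : 0 < B * q%:R * k%:R by rewrite !mulr_gt0.
have s1 : th * nu <= l1.
  rewrite -(@ler_pXn2r _ 2)// ?nnegrE ?mulr_ge0////.
  have h1 : 4 * nu ^+ 2 / eps <= C2 * (l1 / L) ^+ 2.
    by rewrite ler_pdivrMr// mulrAC.
  have h2 : (th * nu) ^+ 2 * 4 <= 128 * (B * q%:R * k%:R) * (C2 * (l1 / L) ^+ 2).
    by rewrite th_nu2 ler_wpM2l// !mulr_ge0//.
  have h3 : 128 * (B * q%:R * k%:R) * (C2 * (l1 / L) ^+ 2) =
      2^-1 * ((q%:R * k%:R) / L ^+ 2) * l1 ^+ 2.
    transitivity (128 * (B * C2) * (q%:R * k%:R) * (l1 / L) ^+ 2); first by ring.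
    by rewrite BC; field; rewrite gt_eqF.
  have h4 : (q%:R * k%:R) / L ^+ 2 <= 4.
    by rewrite ler_pdivrMr ?exprn_gt0//; nra.
  have h5 : 2^-1 * ((q%:R * k%:R) / L ^+ 2) * l1 ^+ 2 <= 2 * l1 ^+ 2.
    by rewrite ler_wpM2r ?sqr_ge0//; lra.
  by have := sqr_ge0 l1; lra.
have s2 : 2 * (th * nu) <= k%:R + l2.
  rewrite -(@ler_pXn2r _ 2)// ?nnegrE ?mulr_ge0 ?addr_ge0////.
  have h1 : 4 * nu ^+ 2 / eps <= C2 * (l2 / L) by rewrite ler_pdivrMr// mulrAC.
  have h2 : (th * nu) ^+ 2 * 4 <= 128 * (B * q%:R * k%:R) * (C2 * (l2 / L)).
    by rewrite th_nu2 ler_wpM2l// !mulr_ge0//.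
  have h3 : 128 * (B * q%:R * k%:R) * (C2 * (l2 / L)) = 2^-1 * (q%:R / L) * (k%:R * l2).
    transitivity (128 * (B * C2) * (q%:R * k%:R) * (l2 / L)); first by ring.
    by rewrite BC; field; rewrite gt_eqF.
  have h4 : q%:R / L <= 2 by rewrite ler_pdivrMr.
  have h5 : 0 <= k%:R * l2 by rewrite mulr_ge0//.
  have h6 : (th * nu) ^+ 2 * 4 <= k%:R * l2.
    by rewrite (le_trans h2)// h3 -[leRHS]mul1r ler_wpM2r//; lra.
  have := sqr_ge0 (k%:R - l2); rewrite exprMn; nra.
set X := expR (th * nu).
have X0 : 0 < X by exact: expR_gt0.
have X00 := ltW X0.
have X1 : X <= E / (C2 * eps).
  have <- : expR l1 = E / (C2 * eps) by rewrite lnK// posrE divr_gt0.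
  by rewrite ler_expR.
have X2 : X ^+ 2 <= expR k%:R * E.
  by rewrite /X -expRM_natl -[in leRHS](lnK E0) -expRD ler_expR.
pose G := (m * 2)%:R^-1 * th ^+ 2 / 2 * X * \sum_(y <- ys) y ^+ 2.
have GE : G = 32 * (B * q%:R * k%:R) * X / (eps * m%:R).
  by rewrite /G ys1 th2 lamE natrM; field; rewrite !gt_eqF.
have p0 : 0 <= (m * 2)%:R^-1 :> R by rewrite invr_ge0.
have G0 : 0 <= G by rewrite GE divr_ge0 ?mulr_ge0//.
have mE' : E * L <= m%:R * (C2 * eps) ^+ 2.
  have mE2 : E * C2 ^- 2 * eps ^- 2 * L = E * L / (C2 * eps) ^+ 2.
    by field; rewrite !gt_eqF.
  by move: mE; rewrite mE2 ler_pdivrMr ?exprn_gt0.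
have G1 : G <= k%:R / 4.
  have h1 : G <= 32 * (B * q%:R * k%:R) * (E / (C2 * eps)) / (eps * m%:R).
    by rewrite GE ler_wpM2r ?invr_ge0 ?mulr_ge0 ?ler_wpM2l// ?mulr_ge0//.
  have h2 : 32 * (B * q%:R * k%:R) * (E / (C2 * eps)) / (eps * m%:R) =
      32 * (B * C2) * (q%:R * k%:R) / L * (E * L / (m%:R * (C2 * eps) ^+ 2)).
    by field; rewrite !gt_eqF.
  have h3 : E * L / (m%:R * (C2 * eps) ^+ 2) <= 1.
    by rewrite ler_pdivrMr ?mul1r// mulr_gt0// exprn_gt0.
  apply: (le_trans h1); rewrite h2 BC.
  have h4 : 32 * 256^-1 * (q%:R * k%:R) / L <= k%:R / 4 :> R.
    by rewrite ler_pdivrMr//; nra.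
  rewrite -[leRHS]mulr1; apply: ler_pM => //.
    by rewrite divr_ge0 ?mulr_ge0//.
  by rewrite divr_ge0 ?mulr_ge0 ?exprn_ge0//.
have G2 : G ^+ 2 <= q%:R / m%:R * (k%:R ^+ 2 * expR k%:R).
  have h1 : G ^+ 2 = (32 * (B * q%:R * k%:R)) ^+ 2 / (eps * m%:R) ^+ 2 * X ^+ 2.
    by rewrite GE; field; rewrite !gt_eqF.
  have h2 : (32 * (B * q%:R * k%:R)) ^+ 2 / (eps * m%:R) ^+ 2 * (expR k%:R * E) =
     (32 * (B * C2)) ^+ 2 * (q%:R / L) * (E * L / (m%:R * (C2 * eps) ^+ 2)) *
      (q%:R / m%:R * (k%:R ^+ 2 * expR k%:R)).
    by field; rewrite !gt_eqF.
  have h3 : E * L / (m%:R * (C2 * eps) ^+ 2) <= 1.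
    by rewrite ler_pdivrMr ?mul1r// mulr_gt0// exprn_gt0.
  have h3' : 0 <= E * L / (m%:R * (C2 * eps) ^+ 2).
    by rewrite divr_ge0 ?mulr_ge0 ?exprn_ge0//.
  have h4 : q%:R / L <= 2 by rewrite ler_pdivrMr.
  have h4' : 0 <= q%:R / L by rewrite divr_ge0//.
  rewrite h1; apply: (@le_trans _ _
    ((32 * (B * q%:R * k%:R)) ^+ 2 / (eps * m%:R) ^+ 2 * (expR k%:R * E))).
    by rewrite ler_wpM2l// ?divr_ge0// sqr_ge0.
  rewrite h2 BC -[leRHS]mul1r ler_wpM2r//; nra.
have := mu_le p0 th0 k0 ysnu (erefl G).
set M := mu _ _ _ => hM.
clearbody G X.
have M0 : 0 <= M by exact: mu_ge0.
have kf : (0 : R) < k`!%:R by rewrite ltr0n fact_gt0.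
have kf0 := ltW kf.
have thk : th ^+ k * th ^+ k = 128 ^+ k * lam ^+ k * k%:R ^+ k.
  by rewrite -!exprMn -th2 expr2.
have fk := fact_le_exp k.
(* As G <= k / 4, exp (2 G + k) <= exp (2 k), and exp 1 <= 4. *)
have e2G : expR G ^+ 2 * expR k%:R <= 16 ^+ k.
  rewrite -expRM_natl -expRD (@le_trans _ _ (expR (k%:R * 2)))//.
    by rewrite ler_expR; lra.
  rewrite expRM_natl (_ : 2 = 1 + 1 :> R)// expRD lerXn2r ?nnegrE ?mulr_ge0 ?expR_ge0//.
  by have := expR1_le4; have := expR_ge0 (1 : R); nra.
have k2 : k%:R ^+ 2 <= 4 ^+ k :> R.
  rewrite (_ : 4 = 2 ^+ 2 :> R); last by ring.
  rewrite exprAC lerXn2r ?nnegrE ?exprn_ge0// -natrX ler_nat.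
  by rewrite ltnW// ltn_expl.
apply: (@le_trans _ _ ((k`!%:R / th ^+ k * (G * expR G)) ^+ 2 * (lam ^+ k / k`!%:R))).
  rewrite ler_wpM2r ?divr_ge0 ?exprn_ge0// lerXn2r ?nnegrE//.
  by rewrite !mulr_ge0 ?expR_ge0 ?invr_ge0 ?exprn_ge0//.
have -> : (k`!%:R / th ^+ k * (G * expR G)) ^+ 2 * (lam ^+ k / k`!%:R) =
   (k`!%:R / k%:R ^+ k) * (128 ^- k * (G ^+ 2 * expR G ^+ 2)).
  transitivity (k`!%:R * lam ^+ k / (th ^+ k * th ^+ k) * (G ^+ 2 * expR G ^+ 2)).
    by field; rewrite !gt_eqF ?exprn_gt0.
  by rewrite thk; field; rewrite !gt_eqF ?exprn_gt0.
rewrite -[leRHS]mul1r ler_pM ?divr_ge0 ?exprn_ge0//.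
- by rewrite mulr_ge0 ?invr_ge0 ?mulr_ge0 ?sqr_ge0 ?exprn_ge0.
- by rewrite ler_pdivrMr ?exprn_gt0// mul1r.
rewrite mulrC ler_pdivrMr ?exprn_gt0//.
(* The 128^k coming from th^(2 k) absorbs 4^k 16^k and leaves 2^(-k), which is summable over the
   orders. *)
have -> : 2^-1 ^+ k * (q%:R / m%:R) * 128 ^+ k = q%:R / m%:R * (4 ^+ k * 16 ^+ k) :> R.
  by rewrite mulrAC -exprMn mulrC -exprMn; congr (_ * _ ^+ k); field.
apply: (le_trans (ler_wpM2r (sqr_ge0 _) G2)).
rewrite -[_ * expR G ^+ 2]mulrA ler_wpM2l ?divr_ge0//.
rewrite -[_ * expR G ^+ 2]mulrA; apply: ler_pM k2 _; first exact: sqr_ge0.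
  by rewrite mulr_ge0 ?expR_ge0 ?sqr_ge0.
by rewrite mulrC.
Qed.

(* Markov's inequality for the moment of order q = 2 ^ e; a power of 2 reduces
   Jensen's inequality in the decoupling to iterated squaring. *)
Lemma hash_tail_unit (T : finType) (eps L E nu : R) (e m : nat) (y : T -> R) :
  0 < eps < 1 -> 0 < L -> L <= (2 ^ e)%:R <= 2 * L -> 1 <= E -> (0 < m)%N -> (0 < e)%N ->
  E * hash_C2 ^- 2 * eps ^- 2 * L <= m%:R ->
  0 <= nu ->
  4 * nu ^+ 2 <= hash_C2 * eps * (ln (E / (hash_C2 * eps)) / L) ^+ 2 ->
  4 * nu ^+ 2 <= hash_C2 * eps * (ln E / L) ->
  (forall a, `|y a| <= nu) -> \sum_a y a ^+ 2 = 1 ->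
  avg (fun c => (eps / 3 < `|@hash_err R T m y c|)%R%:R) <= expR (- 5 * L).
Proof.
move=> he L0 hL E1 m0 ee0 mE nu0 nuA nuB ynu y1.
have /andP[e0 e1] := he; have /andP[Lq qL] := hL.
set q := (2 ^ e)%N in hL Lq qL.
pose lam := hash_B * q%:R / eps.
have qR : (0 : R) < q%:R by exact: lt_le_trans Lq.
have mR : (0 : R) < m%:R by rewrite ltr0n.
have lam0 : 0 < lam by rewrite divr_gt0// mulr_gt0// hash_B_gt0.
have c0 : 0 < eps / 3 by rewrite divr_gt0.
pose F := \sum_(k < q.+1) mu ((m * 2)%:R^-1) (map y (index_enum T)) k ^+ 2 *
      (lam ^+ k / k`!%:R).
(* The term of order 0 is 1 and the others are dominated by a geometric series; hence F^m <= (1 +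
   q/m)^m <= exp q below. *)
have FE : F <= 1 + q%:R / m%:R.
  rewrite /F big_ord_recl mu0 expr0 fact0 divr1 mulr1 expr1n lerD2l.
  apply: (@le_trans _ _ (\sum_(k < q) 2^-1 ^+ k.+1 * (q%:R / m%:R))).
    apply: ler_sum => k _; rewrite lift0.
    apply: (hash_mu_le (k := k.+1) he L0 hL E1 m0 mE nu0 nuA nuB) => //=.
      by move=> _ /mapP[a _ ->].
    by rewrite big_map.
  rewrite -mulr_suml -[leRHS]mul1r ler_wpM2r ?divr_ge0//.
  have -> n : \sum_(k < n) 2^-1 ^+ k.+1 = 1 - 2^-1 ^+ n :> R.
    elim: n => [|n IH]; first by rewrite big_ord0 expr0; ring.
    by rewrite big_ord_recr/= IH exprS; field.
  by rewrite gerBl exprn_ge0// invr_ge0.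
have F0 : 0 <= F.
  by apply: sumr_ge0 => k _; rewrite mulr_ge0 ?sqr_ge0// divr_ge0// exprn_ge0// ltW.
have Fm : F ^+ m <= expR q%:R.
  apply: (@le_trans _ _ (expR (q%:R / m%:R) ^+ m)).
    rewrite lerXn2r ?nnegrE ?expR_ge0//.
    exact: le_trans FE (expR_ge1Dx _).
  by rewrite -expRM_natl mulrC divfK// gt_eqF.
apply: (@le_trans _ _ ((eps / 3) ^- q * avg (fun c => @hash_err R T m y c ^+ q))).
  rewrite -avgZ; apply: le_avg => c.
  have -> : hash_err y c ^+ q = `|hash_err y c| ^+ q.
    by rewrite -normrX ger0_norm// exprn_even_ge0// /q oddX; case: (e) ee0.
  rewrite [leRHS]mulrC -expr_div_n; set z := _ / _.
  case: ltP => [zc|_]; last by rewrite exprn_ge0// divr_ge0// ltW.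
  by rewrite exprn_ege1// /z ler_pdivlMr// mul1r ltW.
apply: (le_trans (ler_wpM2l _ (avg_hash_err_le y e m0 lam0))).
  by rewrite invr_ge0 exprn_ge0// ltW.
rewrite -/q -/F.
apply: (@le_trans _ _ ((eps / 3) ^- q * (4 ^+ q * (q%:R ^+ q / lam ^+ q * expR q%:R)))).
  rewrite ler_wpM2l ?invr_ge0 ?exprn_ge0//; first exact: ltW.
  rewrite ler_wpM2l ?exprn_ge0// ler_pM ?exprn_ge0 ?divr_ge0 ?exprn_ge0//; first exact: ltW.
  rewrite ler_wpM2r ?invr_ge0 ?exprn_ge0//; first exact: ltW.
  exact: fact_le_exp.
have -> : expR q%:R = expR 1 ^+ q :> R by rewrite -expRM_natl mulr1.
rewrite -!exprVn -!exprMn.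
have -> : (eps / 3)^-1 * (4 * (q%:R * lam^-1 * expR 1)) = expR (- 5) :> R.
  have -> : - 5 = 1 - 6 :> R by ring.
  rewrite expRD expRN /lam /hash_B.
  by field; rewrite !gt_eqF// expR_gt0.
rewrite -expRM_natl ler_expR; lra.
Qed.

End HashTail.

(** * Orthogonality of the Walsh-Hadamard matrix *)

Lemma binary_digit_inj k i j : (i < 2 ^ k)%N -> (j < 2 ^ k)%N ->
  (forall b, (b < k)%N -> binary_digit b i = binary_digit b j) -> i = j.
Proof.
elim: k i j => [|k IH] i j; first by rewrite expn0 !ltnS !leqn0 => /eqP-> /eqP->.
move=> ik jk H; rewrite -(odd_double_half i) -(odd_double_half j).
have := H 0%N isT; rewrite /binary_digit expn0 !divn1 => ->.
congr (_ + _.*2)%N; apply: IH.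
- by rewrite -divn2 ltn_divLR// -expnSr.
- by rewrite -divn2 ltn_divLR// -expnSr.
- move=> b bk; have := H b.+1 bk.
  by rewrite /binary_digit expnS !divnMA !divn2.
Qed.

(** Indexing the rows by their digits turns the scalar product of columns j and j' into a product
    over the digits b of 1 + (-1)^(e b). A digit at which j and j' differ has e b = 1 and kills the
    product; if j = j', every factor is 2. *)
Lemma walsh_hadamard_orthogonal (R : realType) n : (exists k, n = 2 ^ k)%N ->
  (walsh_hadamard R n)^T *m walsh_hadamard R n = 1%:M.
Proof.
case=> k ->; apply/matrixP => j j'; rewrite !mxE.
pose e (b : 'I_k) := (binary_digit b j + binary_digit b j')%N.
have n0 : (0 : R) < (2 ^ k)%:R by rewrite ltr0n expn_gt0.
pose dig (i : 'I_(2 ^ k)) := [ffun b : 'I_k => binary_digit b i].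
have bdig : bijective dig.
  apply: inj_card_bij; last by rewrite card_ffun card_bool !card_ord.
  move=> x x' /ffunP H; apply/val_inj/(@binary_digit_inj k); [exact: ltn_ord..|move=> b bk].
  by have := H (Ordinal bk); rewrite !ffunE.
transitivity ((2 ^ k)%:R^-1 * \sum_(i < 2 ^ k) \prod_(b < k) ((-1) ^+ (dig i b * e b) : R)).
  rewrite mulr_sumr; apply: eq_bigr => i _; rewrite !mxE mulrACA -invfM -expr2.
  rewrite sqr_sqrtr ?ltW// up_expnK// -exprD -big_split -expr_sum; congr (_ * _ ^+ _).
  by apply: eq_bigr => b _; rewrite ffunE mulnDr.
transitivity ((2 ^ k)%:R^-1 * \sum_(f : {ffun 'I_k -> bool})
    \prod_(b < k) ((-1) ^+ (f b * e b) : R)).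
  by rewrite [in RHS](reindex dig)//; exact: onW_bij.
rewrite -(bigA_distr_bigA (fun b (v : bool) => (-1) ^+ (v * e b))).
under eq_bigr do rewrite big_bool /= mul1n mul0n expr0.
have [jj|jj] := eqVneq j j'; last first.
  have [b eb] : exists b, e b = 1%N.
    have [b Hb] : exists b : 'I_k, binary_digit b j != binary_digit b j'.
      apply/existsP; apply: contraNT jj; rewrite negb_exists => /forallP H.
      apply/eqP/val_inj/(@binary_digit_inj k); [exact: ltn_ord..|move=> b bk].
      by have := H (Ordinal bk); rewrite negbK => /eqP.
    by exists b; rewrite /e; case: binary_digit Hb; case: binary_digit.
  by rewrite (bigD1 b)//= eb expr1 addNr mul0r mulr0.
rewrite (eq_bigr (fun=> 2)) => [|b _].
  by rewrite prodr_const card_ord -natrX mulVf ?gt_eqF.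
by rewrite /e jj addnn -signr_odd odd_double.
Qed.

(** * Finite uniform laws of the random matrices *)

Definition pr (R : realType) (I : finType) (Q : I -> Prop) : R :=
  avg (fun i => `[< Q i >]%:R).

Section FiniteLaw.
Context {disp : measure_display} {Omega : measurableType disp} {R : realType}.
Variable P : probability Omega R.

Lemma sum_fibers (I : finType) (c : Omega -> I) (A : set Omega) :
  measurable A -> (forall i, measurable (c @^-1` [set i])) ->
  P A = (\sum_i P (A `&` c @^-1` [set i]))%E.
Proof.
move=> mA mc.
have {1}-> : A = \bigcup_(i in [set` enum I]) (A `&` c @^-1` [set i]).
  rewrite -setI_bigcupr; apply/esym/setIidl => w _.
  by exists (c w) => //=; rewrite mem_enum.
rewrite measure_fin_bigcup//.
- by rewrite -fsbig_seq ?enum_uniq// big_enum.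
- exact: trivIset_preimage1_in.
- by move=> i _; exact: measurableI.
Qed.

(** Whatever factors through a uniform finite variable has a law given by counting, which replaces
    events of [Omega] by averages. *)
Lemma uniform_law (I : finType) (c : Omega -> I) (V : Type) (f : I -> V) (T : Omega -> V) :
  (forall i, measurable (c @^-1` [set i])) ->
  (forall i, P (c @^-1` [set i]) = (#|I|%:R^-1)%:E) ->
  (forall w, T w = f (c w)) ->
  forall B : set V, measurable (T @^-1` B) /\ P (T @^-1` B) = (pr R (fun i => B (f i)))%:E.
Proof.
move=> mc Pc Tf B.
have -> : T @^-1` B = \bigcup_(i in [set i | B (f i)]) c @^-1` [set i].
  apply/seteqP; split => w /=; first by rewrite Tf => Bw; exists (c w).
  by case=> i /= Bi /= cw; rewrite Tf cw.
have mB : measurable (\bigcup_(i in [set i | B (f i)]) c @^-1` [set i]).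
  by apply: fin_bigcup_measurable => // i _; exact: mc.
split => //; rewrite (sum_fibers mB mc) /pr /avg mulr_sumr -sumEFin.
apply: eq_bigr => i _; case: asboolP => Bi.
  rewrite mulr1 -(Pc i); congr (P _); apply/setIidr => w /= cw.
  by exists i.
rewrite mulr0.
have -> : \bigcup_(i0 in [set i0 | B (f i0)]) c @^-1` [set i0] `&` c @^-1` [set i] = set0.
  by apply/seteqP; split => // w [[j /= Bj /= ->] ji]; apply: Bi; rewrite -ji.
by rewrite measure0.
Qed.

Lemma random_sign_bsign (x : Omega -> R) b : random_sign P x ->
  P (x @^-1` [set bsign R b]) = (2^-1)%:E.
Proof. by case=> _ _ P1 PN1; case: b; rewrite /bsign ?expr1 ?expr0. Qed.

Lemma bsign_inj : injective (bsign R).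
Proof.
have H : ((-1 : R) == 1) = false by rewrite eqNr oner_eq0.
by case=> -[]//; rewrite /bsign expr0 expr1 => /eqP; rewrite ?[1 == _]eq_sym H.
Qed.

Lemma preimage_sign (x : Omega -> R) b : random_sign P x ->
  x @^-1` [set bsign R b] = (fun w => x w == -1) @^-1` [set b].
Proof.
have H : (1 : R) == -1 = false by rewrite eq_sym eqNr oner_eq0.
case=> _ xs _ _; apply/seteqP; split => w /=.
  by move=> ->; case: b; rewrite /bsign ?expr1 ?expr0 ?eqxx ?H.
by move=> <-; case: (xs w) => ->; rewrite ?eqxx ?H /bsign ?expr1 ?expr0.
Qed.

Definition sign_diag n (xi : {ffun 'I_n -> bool}) : 'M[R]_n :=
  diag_mx (\row_j bsign R (xi j)).

Lemma sign_diag_law n (D : Omega -> 'M[R]_n) : random_sign_diagonal P D ->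
  forall B, measurable (D @^-1` B) /\ P (D @^-1` B) = (pr R (fun xi => B (sign_diag xi)))%:E.
Proof.
case=> x [xs xind DE].
pose c w := [ffun j => x j w == -1].
(* Each fiber is an intersection over all coordinates, so mutual independence for the full index set
   gives all fibers the same mass. *)
have cE xi : c @^-1` [set xi] =
    \bigcap_(j in [set` [set: 'I_n]%SET]) x j @^-1` [set bsign R (xi j)].
  apply/seteqP; split => w /=.
    move=> <- j _; rewrite preimage_sign//= ffunE//.
  by move=> H; apply/ffunP => j; have := H j; rewrite preimage_sign//= ffunE inE; exact.
apply: (@uniform_law _ c _ (@sign_diag n)).
- move=> xi; rewrite cE; apply: fin_bigcap_measurable => // j _.
  by case: (xs j) => mx _ _ _; exact: mx.
- move=> xi; rewrite cE xind; last by move=> j _; exists [set bsign R (xi j)].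
  under eq_bigr do rewrite random_sign_bsign//.
  by rewrite prodEFin prodr_const card_ffun card_bool cardsT natrX exprVn.
- move=> w; rewrite DE /sign_diag; congr diag_mx; apply/rowP => j; rewrite !mxE ffunE.
  have : (x j @^-1` [set bsign R (x j w == -1)]) w by rewrite preimage_sign.
  by [].
Qed.

Definition hash_mx m n s (c : {ffun 'I_n * 'I_s -> 'I_m} * {ffun 'I_n * 'I_s -> bool}) :
    'M[R]_(m, n) :=
  \matrix_(i, j) \sum_(k < s | c.1 (j, k) == i) (bsign R (c.2 (j, k)) / Num.sqrt s%:R).

Lemma hashing_variant_law m n s (T : Omega -> 'M[R]_(m, n)) : hashing_variant P s T ->
  forall B, measurable (T @^-1` B) /\
    P (T @^-1` B) = (pr R (fun c => B (@hash_mx m n s c)))%:E.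
Proof.
case=> idx [sgn [idxu sgns ind TE]].
pose c w := ([ffun p => idx p.1 p.2 w] : {ffun 'I_n * 'I_s -> 'I_m},
             [ffun p => sgn p.1 p.2 w == -1] : {ffun 'I_n * 'I_s -> bool}).
pose ev (hg : {ffun 'I_n * 'I_s -> 'I_m} * {ffun 'I_n * 'I_s -> bool}) u :=
  match u with
  | inl p => idx p.1 p.2 @^-1` [set hg.1 p]
  | inr p => sgn p.1 p.2 @^-1` [set bsign R (hg.2 p)]
  end.
have cE hg : c @^-1` [set hg] =
    \bigcap_(u in [set` [set: ('I_n * 'I_s) + ('I_n * 'I_s)]%SET]) ev hg u.
  apply/seteqP; split => w /=.
    move=> <- [p _|p _]; first by rewrite /= ffunE.
    by rewrite /ev preimage_sign//= ffunE.
  case: hg => h g H; congr (_, _); apply/ffunP => p; rewrite ffunE.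
    by have /= := H (inl p) (finset.in_setT _).
  by have := H (inr p) (finset.in_setT _); rewrite /ev preimage_sign.
apply: (@uniform_law _ c _ (@hash_mx m n s)).
- move=> hg; rewrite cE; apply: fin_bigcap_measurable => // -[] p _ /=.
    by case: (idxu p.1 p.2) => mx _; exact: mx.
  by case: (sgns p.1 p.2) => mx _ _ _; exact: mx.
- move=> hg; rewrite cE ind; last first.
    by case=> p _ /=; [exists [set hg.1 p] | exists [set bsign R (hg.2 p)]].
  under eq_bigl do rewrite inE.
  rewrite big_sumType/=.
  under eq_bigr do rewrite (idxu _ _).2.
  under [X in (_ * X)%E]eq_bigr do rewrite random_sign_bsign//.
  rewrite !prodEFin !prodr_const.
  have -> : #|{: {ffun 'I_n * 'I_s -> 'I_m} * {ffun 'I_n * 'I_s -> bool}}| =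
      (m ^ #|{: 'I_n * 'I_s}| * 2 ^ #|{: 'I_n * 'I_s}|)%N.
    by rewrite [LHS]card_prod !card_ffun card_bool card_ord.
  by rewrite -EFinM natrM !natrX invfM !exprVn.
- move=> w; rewrite TE; apply/matrixP => i j; rewrite !mxE.
  apply: eq_big => k; first by rewrite ffunE.
  move=> _; rewrite ffunE/=; congr (_ / _).
  have : (sgn j k @^-1` [set bsign R (sgn j k w == -1)]) w by rewrite preimage_sign.
  by [].
Qed.

(* Only the matrix S_h, not its indices and signs, is known to be independent
   of D, so D is conditioned on through its values. *)
Lemma pr_HRHT_ge m n s (Sh : Omega -> 'M[R]_(m, n)) (D : Omega -> 'M[R]_n)
    (Q : 'M[R]_(m, n) -> 'M[R]_n -> Prop) (G : {ffun 'I_n -> bool} -> Prop) (a b : R) :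
  hashing_variant P s Sh -> random_sign_diagonal P D -> independent_rv P Sh D ->
  0 <= a -> b <= pr R G ->
  (forall xi, G xi -> a <= pr R (fun c => Q (@hash_mx m n s c) (sign_diag xi))) ->
  ((a * b)%:E <= P [set w | Q (Sh w) (D w)])%E.
Proof.
move=> hSh hD ind a0 bG aQ.
have hL := hashing_variant_law hSh; have dL := sign_diag_law hD.
(* Distinct sign patterns give distinct matrices, so the events D = [sign_diag xi] are disjoint and
   each has probability 2^(-n). *)
have sdi : injective (@sign_diag n).
  move=> xi xi' /matrixP H; apply/ffunP => j; apply: bsign_inj.
  by have := H j j; rewrite !mxE eqxx !mulr1n.
pose ev xi := Sh @^-1` [set M | Q M (sign_diag xi)] `&` D @^-1` [set sign_diag xi].
have mev xi : measurable (ev xi).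
  by apply: measurableI; [exact: (hL _).1 | exact: (dL _).1].
have PD (xi : {ffun 'I_n -> bool}) :
    P (D @^-1` [set sign_diag xi]) = (#|{ffun 'I_n -> bool}|%:R^-1)%:E.
  rewrite (dL _).2 /pr /avg (bigD1 xi)//= asboolT// big1 ?addr0 ?mulr1// => xi' ne.
  by rewrite asboolF// => /sdi /eqP; rewrite (negbTE ne).
have -> : [set w | Q (Sh w) (D w)] = \bigcup_(xi in [set` enum {ffun 'I_n -> bool}]) ev xi.
  apply/seteqP; split => w /=; last by case=> xi _ [/= + /= ->].
  case: hD => x [xs _ DE] QD.
  have DxE : D w = sign_diag [ffun j => x j w == -1].
    rewrite DE /sign_diag; congr diag_mx; apply/rowP => j; rewrite !mxE ffunE.
    have : (x j @^-1` [set bsign R (x j w == -1)]) w by rewrite preimage_sign.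
    by [].
  exists [ffun j => x j w == -1]; first by rewrite /= mem_enum.
  by split => /=; rewrite -?DxE.
rewrite measure_fin_bigcup//; last first.
  by move=> xi xi' _ _ [w [[_ /= h1] [_ /= h2]]]; apply: sdi; rewrite -h1 -h2.
rewrite -fsbig_seq ?enum_uniq// big_enum/=.
have Pev xi : P (ev xi) =
    (#|{ffun 'I_n -> bool}|%:R^-1 * pr R (fun c => Q (@hash_mx m n s c) (sign_diag xi)))%:E.
  have := ind [set: bool]%SET (fun b => if b then Sh @^-1` [set M | Q M (sign_diag xi)]
    else D @^-1` [set sign_diag xi]).
  have -> : \bigcap_(i in [set` [set: bool]%SET])
    (if i then Sh @^-1` [set M | Q M (sign_diag xi)]
    else D @^-1` [set sign_diag xi]) = ev xi.
    apply/seteqP; split => w /=.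
      move=> H; split; first exact: (H true (finset.in_setT _)).
      exact: (H false (finset.in_setT _)).
    by move=> [H1 H2] [] _.
  move=> ->; last first.
    by case=> _ /=; [exists [set M | Q M (sign_diag xi)] | exists [set sign_diag xi]].
  under eq_bigl do rewrite inE.
  by rewrite big_bool/= PD (hL _).2 -EFinM mulrC.
under eq_bigr do rewrite Pev.
rewrite sumEFin lee_fin -mulr_sumr.
apply: (@le_trans _ _ (a * pr R G)); first by rewrite ler_wpM2l.
rewrite /pr -avgZ; apply: le_avg => xi; case: asboolP => [/aQ|_].
  by rewrite mulr1.
by rewrite mulr0 mulr_ge0 ?invr_ge0// sumr_ge0.
Qed.

End FiniteLaw.

(** * Union bounds and reduction to the grid *)

Section Assembly.
Variable R : realType.

(** Pointwise, 1 is at most the indicator of [Q] plus the number of bad [f] in [F]; then one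
    averages. *)
Lemma pr_union_bound (I K : finType) (F : {set K}) (bad : K -> I -> bool)
    (Q : I -> Prop) (b : R) : (0 < #|I|)%N ->
  (forall i, (forall f, f \in F -> ~~ bad f i) -> Q i) ->
  (forall f, f \in F -> avg (fun i => (bad f i)%:R) <= b) ->
  1 - #|F|%:R * b <= pr R Q.
Proof.
move=> I0 Qbad badb; rewrite lerBlDr.
have avgD (F1 F2 : I -> R) : avg (fun i => F1 i + F2 i) = avg F1 + avg F2.
  by rewrite /avg big_split mulrDr.
apply: (@le_trans _ _ (pr R Q + \sum_(f in F) avg (fun i => (bad f i)%:R))); last first.
  rewrite lerD2l mulr_natl -sumr_const.
  exact: ler_sum.
rewrite -avg_sum -avgD -[leLHS](avg_cst (I := I))//; apply: le_avg => i.
case: asboolP => [_|nQ]; first by rewrite lerDl sumr_ge0.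
have [f fF bf] : exists2 f, f \in F & bad f i.
  apply/exists_inP; apply: contra_notT nQ; rewrite negb_exists_in => /forall_inP h.
  exact: Qbad.
by rewrite add0r (bigD1 f)//= bf lerDl sumr_ge0.
Qed.

Lemma walsh_hadamard_sqr n i j : (0 < n)%N -> walsh_hadamard R n i j ^+ 2 = n%:R^-1.
Proof.
move=> n0; rewrite mxE exprMn exprVn sqr_sqrtr//.
by rewrite -exprM mulnC exprM sqrrN expr1n expr1n mulr1.
Qed.

(** Entry i of H D u is a signed sum whose squared coefficients add up to |u|^2 / n, and Hoeffding's
    inequality applies with t^2 = b |u|^2 / n. The case u = 0 is apart since [hoeffding] asks for V
    > 0. *)
Lemma sign_flattening_tail n (H : 'M[R]_n) (u : 'cV[R]_n) (b : R) i : (0 < n)%N -> 0 < b ->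
  (forall j k, H j k ^+ 2 = n%:R^-1) ->
  avg (fun xi => (b * sqnorm u / n%:R < (H *m sign_diag xi *m u) i 0 ^+ 2)%R%:R)
  <= 2 * expR (- b / 8).
Proof.
move=> n0 b0 H2; have nR : (0 : R) < n%:R by rewrite ltr0n.
have [/sqnorm_eq0 ->|u0] := eqVneq (sqnorm u) 0.
  rewrite /avg big1 ?mulr0 ?mulr_ge0 ?expR_ge0// => xi _.
  rewrite mulmx0 mxE expr0n ltNge.
  by rewrite mulr_ge0 ?invr_ge0// mulr_ge0 ?sqnorm_ge0// ltW.
have up : 0 < sqnorm u by rewrite lt_def u0 sqnorm_ge0.
have V0 : 0 < sqnorm u / n%:R by rewrite divr_gt0.
pose t := Num.sqrt (b * (sqnorm u / n%:R)).
have t2 : t ^+ 2 = b * (sqnorm u / n%:R).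
  by rewrite sqr_sqrtr// mulr_ge0// ltW.
have t0 : 0 < t by rewrite sqrtr_gt0 mulr_gt0.
clearbody t.
have := @hoeffding R _ (fun j => H i j * u j 0) _ _ V0 t0 _.
rewrite t2 -mulNr => h; apply: le_trans (le_trans (h _) _).
- apply: le_avg => xi; rewrite -mulrA -t2.
  have -> : (H *m sign_diag xi *m u) i 0 = \sum_a bsign R (xi a) * (H i a * u a 0).
    rewrite mxE; apply: eq_bigr => j _; rewrite mxE (bigD1 j)//= big1 ?addr0.
      by rewrite !mxE eqxx mulr1n; ring.
    by move=> k kj; rewrite !mxE (negbTE kj) mulr0n mulr0.
  by rewrite -[X in _ < X]real_normK ?num_real// ltr_pXn2r// ?nnegrE ltW.
- rewrite /sqnorm mulr_suml ler_sum// => j _.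
  by rewrite exprMn H2 mulrC.
- apply: le_of_eq; congr (_ * expR _); field; rewrite !gt_eqF//.
Qed.

Lemma sqnorm_hash_mx m n s (v : 'cV[R]_n) c : (0 < s)%N ->
  sqnorm (@hash_mx R m n s c *m v) - sqnorm v =
  hash_err (fun a => v a.1 0 / Num.sqrt s%:R) c.
Proof.
move=> s0; rewrite /hash_err; congr (_ - _).
  apply: eq_bigr => i _; congr (_ ^+ 2); rewrite mxE.
  transitivity (\sum_j \sum_(k | c.1 (j, k) == i)
      bsign R (c.2 (j, k)) * (v j 0 / Num.sqrt s%:R)).
    apply: eq_bigr => j _; rewrite mxE mulr_suml; apply: eq_bigr => k _.
    by rewrite mulrAC mulrA.
  rewrite pair_big_dep/=; apply: eq_big => [[]|[]]//.
transitivity (\sum_j \sum_(k < s) (v j 0 / Num.sqrt s%:R) ^+ 2); last first.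
  by rewrite pair_big.
apply: eq_bigr => j _; rewrite sumr_const card_ord exprMn exprVn sqr_sqrtr//.
by rewrite -[RHS]mulr_natr divfK// pnatr_eq0 -lt0n.
Qed.

Lemma qform_gram m r (B : 'M[R]_(m, r)) x :
  qform (B^T *m B - 1%:M) x = sqnorm (B *m x) - sqnorm x.
Proof.
have qE (M : 'M[R]_r) : qform M x = (x^T *m M *m x) 0 0.
  rewrite mxE /qform exchange_big; apply: eq_bigr => j _.
  by rewrite mxE mulr_suml; apply: eq_bigr => i _; rewrite mxE.
rewrite qE !sqnormE mulmxBr mulmx1 mulmxBl [in LHS]mxE [X in _ + X]mxE.
by rewrite trmx_mul !mulmxA.
Qed.

Lemma norm2_sqr n (v : 'cV[R]_n) : norm2 v ^+ 2 = sqnorm v.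
Proof. by rewrite sqr_sqrtr// sqnorm_ge0. Qed.

(** As U is an isometry, x enters only through z = C x, and the distortion is the quadratic form of
    (S U)^T (S U) - 1; [qform_net] turns eps / 3 on the grid into eps everywhere. *)
Lemma subspace_embedding_net m n d r (eps : R) (S : 'M[R]_(m, n)) (U : 'M[R]_(n, r))
    (C : 'M[R]_(r, d)) : (0 < r)%N -> 0 <= eps -> U^T *m U = 1%:M ->
  (forall f : {ffun 'I_r -> bool * 'I_(16 * r).+1}, in_grid f ->
     `|sqnorm (S *m U *m grid_point R f) - sqnorm (grid_point R f)|
       <= eps / 3 * sqnorm (grid_point R f)) ->
  subspace_embedding eps S (U *m C).
Proof.
move=> r0 eps0 UU grid x; rewrite !norm2_sqr.
have -> : S *m (U *m C) *m x = S *m U *m (C *m x) by rewrite !mulmxA.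
rewrite -mulmxA (sqnorm_isometry _ UU); move: (C *m x) => z.
have H := @qform_net R r ((S *m U)^T *m (S *m U) - 1%:M)
  [set grid_point R f | f in [set f | in_grid f]] (eps / 3) r0 _ _ _ z.
have : `|qform ((S *m U)^T *m (S *m U) - 1%:M) z| <= 3 * (eps / 3) * sqnorm z.
  apply: H.
  - by rewrite divr_ge0.
  - move=> y y16; have [f [gf f16 fr]] := grid_rounding y16.
    by exists (grid_point R f); split => //; exists f.
  - by move=> _ [f gf <-]; rewrite qform_gram; exact: grid.
rewrite qform_gram ler_norml => /andP[h1 h2].
by apply/andP; split; lra.
Qed.

(** The least power of 2 that is at least L: minimality gives the factor 2, and L > 1 excludes 2^0,
    so the moment order is even. *)
Lemma ex_pow2_between (L : R) : 1 < L ->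
  exists2 e, (0 < e)%N & L <= (2 ^ e)%:R <= 2 * L.
Proof.
move=> L1; have ex : exists e, L <= (2 ^ e)%:R.
  exists (Num.bound L); apply: ltW; apply: lt_le_trans (archi_boundP _) _; first lra.
  by rewrite ler_nat ltnW// ltn_expl.
case: (ex_minnP ex) => -[|e] Le mine.
  by move: Le; rewrite expn0 leNgt L1.
exists e.+1 => //; rewrite Le/= expnS natrM ler_wpM2l//.
by rewrite leNgt; apply/negP => /ltW /mine; rewrite ltnn.
Qed.

(** Homogeneous form of [hash_tail_unit], by dividing y by sqrt Y; if Y = 0 then y = 0 and the error
    vanishes. *)
Lemma hash_err_tail (T : finType) (eps L E nu Y : R) (e m : nat) (y : T -> R) :
  0 < eps < 1 -> 0 < L -> L <= (2 ^ e)%:R <= 2 * L -> 1 <= E -> (0 < m)%N -> (0 < e)%N ->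
  E * hash_C2 R ^- 2 * eps ^- 2 * L <= m%:R ->
  0 <= nu ->
  4 * nu ^+ 2 <= hash_C2 R * eps * (ln (E / (hash_C2 R * eps)) / L) ^+ 2 ->
  4 * nu ^+ 2 <= hash_C2 R * eps * (ln E / L) ->
  (forall a, y a ^+ 2 <= nu ^+ 2 * Y) -> \sum_a y a ^+ 2 = Y ->
  avg (fun c => (eps / 3 * Y < `|@hash_err R T m y c|)%R%:R) <= expR (- 5 * L).
Proof.
move=> he L0 hL E1 m0 e0 mE nu0 nuA nuB ynu yY.
have Y0 : 0 <= Y by rewrite -yY sumr_ge0// => a _; exact: sqr_ge0.
have [YE|Yn] := eqVneq Y 0.
  rewrite /avg big1 ?mulr0 ?expR_ge0// => c _.
  have y0 a : y a = 0.
    by apply/eqP; rewrite -sqrf_eq0 eq_le sqr_ge0 andbT (le_trans (ynu a))// YE mulr0.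
  rewrite (_ : hash_err y c = 0) ?YE ?mulr0 ?normr0 ?ltxx//.
  rewrite /hash_err !big1 ?subr0// => [a _|i _]; first by rewrite y0 expr0n.
  by rewrite big1 ?expr0n// => a _; rewrite y0 mulr0.
have Yp : 0 < Y by rewrite lt_def Yn.
have sY : Num.sqrt Y ^+ 2 = Y by rewrite sqr_sqrtr.
have sY0 : 0 < Num.sqrt Y by rewrite sqrtr_gt0.
apply: le_trans (hash_tail_unit he L0 hL E1 m0 e0 mE nu0 nuA nuB
  (y := fun a => (Num.sqrt Y)^-1 * y a) _ _).
- apply: le_avg => c; rewrite hash_errZ exprVn sY normrM gtr0_norm ?invr_gt0//.
  by rewrite [_ * `|_|]mulrC ltr_pdivlMr.
- move=> a; rewrite -(@ler_pXn2r _ 2)// ?nnegrE// real_normK ?num_real//.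
  by rewrite exprMn exprVn sY mulrC ler_pdivrMr.
- by under eq_bigr do rewrite exprMn exprVn sY; rewrite -mulr_sumr yY mulVf.
Qed.

Lemma sign_diag_orthogonal n (xi : {ffun 'I_n -> bool}) :
  (sign_diag xi : 'M[R]_n)^T *m sign_diag xi = 1%:M.
Proof.
rewrite tr_diag_mx mulmx_diag -diag_const_mx; congr diag_mx; apply/rowP => j.
by rewrite !mxE -expr2 /bsign -exprM mulnC exprM sqrrN expr1n expr1n.
Qed.

Lemma mulmx_isometry m n p (U : 'M[R]_(m, n)) (V : 'M[R]_(n, p)) :
  U^T *m U = 1%:M -> V^T *m V = 1%:M -> (U *m V)^T *m (U *m V) = 1%:M.
Proof. by move=> UU VV; rewrite trmx_mul -mulmxA (mulmxA U^T) UU mul1mx. Qed.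

Lemma pow2_le_expR k : 2 ^+ k <= expR k%:R :> R.
Proof.
rewrite -[k%:R]mulr1 expRM_natl lerXn2r ?nnegrE ?expR_ge0//.
by have := expR_ge1Dx (1 : R); lra.
Qed.

(** The factor exp (- 20 r) pays for the 2^(18 r) grid points and for the 2 of the two-sided tail,
    as 18 r + 1 <= 20 r. *)
Lemma pow2_mul_expRN_le r : (0 < r)%N ->
  2 ^+ (18 * r) * 2 * expR (- (20 * r)%:R) <= 1 :> R.
Proof.
move=> r0; rewrite expRN ler_pdivrMr ?expR_gt0// mul1r -exprSr.
by apply: le_trans (pow2_le_expR _) _; rewrite ler_expR ler_nat; lia.
Qed.

Lemma union_bound_arith (N K x y delta n : R) :
  N <= K -> 0 <= N -> 0 <= x -> 0 < delta -> 0 < n -> K * 2 * y <= 1 ->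
  x <= y * (delta / n) -> N * (n * (2 * x)) <= delta.
Proof.
move=> NK N0 x0 d0 n0 Ky xy; have dn0 : 0 < delta / n by exact: divr_gt0.
apply: (@le_trans _ _ (K * (n * (2 * (y * (delta / n)))))).
  apply: ler_pM => //; first by rewrite !mulr_ge0// ltW.
  by rewrite ler_pM2l// ler_pM2l.
have -> : K * (n * (2 * (y * (delta / n)))) = K * 2 * y * delta.
  by field; rewrite gt_eqF.
by rewrite -[leRHS]mul1r ler_pM2r.
Qed.

End Assembly.

(** * Choice of the constants and conclusion *)

Theorem theorem2p4p5 (R : realType) :
  exists C C1 C2 : R,
    [/\ 0 < C, 0 < C1 & 0 < C2] /\
    forall (eps delta : R) (s r d m n : nat) (E : R),
      0 < eps < 1 -> 0 < delta < 1 ->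
      (0 < s)%N -> (0 < r)%N -> (0 < d)%N -> (0 < m)%N -> (0 < n)%N ->
      (r <= d <= n)%N -> (m <= n)%N ->
      (exists k : nat, n = (2 ^ k)%N) ->
      0 < E ->
      C <= E <= 2 * expR (4 * r%:R) / ((4 * r%:R + ln delta^-1) * delta) ->
      E * C2 ^- 2 * eps ^- 2 * (4 * r%:R + ln delta^-1) <= m%:R ->
      forall delta1 : R,
        0 < delta1 < 1 ->
        (Num.sqrt r%:R + Num.sqrt (8 * ln (n%:R / delta1))) ^+ 2
          / (s%:R * mu_bar C1 C2 E r eps delta ^+ 2) <= n%:R ->
        forall A : 'M[R]_(n, d),
          \rank A = r ->
          forall (disp : measure_display) (Omega : measurableType disp)
                 (P : probability Omega R) (S : Omega -> 'M[R]_(m, n)),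
            HRHT P s S ->
            (((1 - delta) * (1 - delta1))%:E
               <= P [set w | subspace_embedding eps (S w) A])%E.
Proof.
(* C = 2 makes ln E positive. C1 = 1/26 is chosen because 26^2 = 676 exceeds 4 * 160 = 640, where
   160 is the factor in [b] below. *)
exists 2, (26^-1), (hash_C2 R); split; first by split => //; exact: hash_C2_gt0.
move=> eps delta s r d m n E he /andP[d0 d1] s0 r0 _ m0 n0 _ _ npow E0 /andP[E2 _] mE
  delta1 /andP[dd0 dd1] rho A rA disp Omega P S [_ [Sh [D [hSh hD ind SE]]]].
have := hash_C2_gt0 R; have := hash_C2_lt1 R.
move: (hash_C2 R) (@hash_err_tail R) mE rho => C2 tail mE rho C21 C20.
have /andP[e0 e1] := he.
have [r' [U [C [UU AUC r'E]]]] := gram_schmidt A.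
rewrite rA in r'E; subst r'.
have rR : (1 : R) <= r%:R by rewrite ler1n.
have nR : (0 : R) < n%:R by rewrite ltr0n.
have sR : (0 : R) < s%:R by rewrite ltr0n.
have ld0 : 0 < ln delta^-1 by rewrite ln_gt0// invf_gt1.
set L := 4 * r%:R + ln delta^-1 in mE rho.
have L4 : 4 <= L by rewrite /L; lra.
have L0 : 0 < L by lra.
have L1 : 1 < L by lra.
have [e ee eL] := ex_pow2_between L1.
set rho2 := (_ + _) ^+ 2 in rho.
have w0 : 0 < ln (n%:R / delta1).
  rewrite ln_gt0// ltr_pdivlMr// mul1r (lt_le_trans dd1)// ler1n//.
have rho2_ge : r%:R + 8 * ln (n%:R / delta1) <= rho2.
  have a2 : Num.sqrt r%:R ^+ 2 = r%:R :> R by rewrite sqr_sqrtr.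
  have b2 : Num.sqrt (8 * ln (n%:R / delta1)) ^+ 2 = 8 * ln (n%:R / delta1).
    by rewrite sqr_sqrtr// mulr_ge0// ltW.
  rewrite /rho2 sqrrD a2 b2.
  have := mulr_ge0 (sqrtr_ge0 (r%:R : R)) (sqrtr_ge0 (8 * ln (n%:R / delta1))).
  by lra.
have rho20 : 0 < rho2 by lra.
(* Then b / 8 >= 20 r + 160 ln (n / delta1), so Hoeffding's bound pays for the grid and for the n
   entries of each vector. *)
pose b := 160 * rho2.
have b0 : 0 < b by rewrite mulr_gt0.
(* For a flattened unit vector the squared entries are at most b / n, and splitting into s draws
   divides them by s. *)
pose nu := Num.sqrt (b / (n%:R * s%:R)).
have nu2 : nu ^+ 2 = b / (n%:R * s%:R).
  by rewrite sqr_sqrtr// divr_ge0 ?mulr_ge0// ltW.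
have l20 : 0 < ln E by rewrite ln_gt0//; lra.
have ECe : 1 < E / (C2 * eps).
  by rewrite ltr_pdivlMr ?mulr_gt0// mul1r; nra.
have l10 : 0 < ln (E / (C2 * eps)) by rewrite ln_gt0.
pose mn := Num.min (ln (E / (C2 * eps)) / L) (Num.sqrt (ln E / L)).
have mn0 : 0 < mn by rewrite /mn lt_min divr_gt0// sqrtr_gt0 divr_gt0.
have mu2 : mu_bar 26^-1 C2 E r eps delta ^+ 2 = 676^-1 * (C2 * eps) * mn ^+ 2.
  rewrite /mu_bar -/L -/mn !exprMn !sqr_sqrtr ?ltW//.
  by field.
(* The hypothesis on n reads 676 rho2 <= n s C2 eps mn^2, while 4 nu^2 n s = 640 rho2. *)
have nu_mn : 4 * nu ^+ 2 <= C2 * eps * mn ^+ 2.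
  have mm0 : 0 < C2 * eps * mn ^+ 2 by rewrite !mulr_gt0// exprn_gt0.
  have smu : 0 < s%:R * (676^-1 * (C2 * eps) * mn ^+ 2).
    have c0 : (0 : R) < 676^-1 by rewrite invr_gt0 ltr0n.
    exact: mulr_gt0 sR (mulr_gt0 (mulr_gt0 c0 (mulr_gt0 C20 e0)) (exprn_gt0 2 mn0)).
  move: rho; rewrite mu2 ler_pdivrMr//.
  move=> h; rewrite nu2 mulrA ler_pdivrMr ?mulr_gt0// /b.
  have ns : 0 < n%:R * s%:R :> R by rewrite mulr_gt0.
  have h' : rho2 <= 676^-1 * (C2 * eps * mn ^+ 2 * (n%:R * s%:R)).
    by apply: le_trans h _; apply: le_of_eq; ring.
  by have := mulr_gt0 mm0 ns; lra.
have Ce0 : 0 <= C2 * eps by rewrite ltW// mulr_gt0.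
have nuA : 4 * nu ^+ 2 <= C2 * eps * (ln (E / (C2 * eps)) / L) ^+ 2.
  apply: le_trans nu_mn (ler_wpM2l Ce0 _).
  by rewrite ler_pXn2r// ?nnegrE ?divr_ge0 ?(ltW l10) ?(ltW L0) ?(ltW mn0)// /mn ge_min lexx.
have nuB : 4 * nu ^+ 2 <= C2 * eps * (ln E / L).
  apply: le_trans nu_mn (ler_wpM2l Ce0 _).
  have -> : ln E / L = Num.sqrt (ln E / L) ^+ 2.
    by rewrite sqr_sqrtr// divr_ge0// ltW.
  by rewrite ler_pXn2r// ?nnegrE ?sqrtr_ge0 ?(ltW mn0)// /mn ge_min lexx orbT.
have E1 : 1 <= E by lra.
pose H := walsh_hadamard R n.
have HH : H^T *m H = 1%:M := walsh_hadamard_orthogonal R npow.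
pose z f : 'cV[R]_r := grid_point R f.
pose grid := [set f : {ffun 'I_r -> bool * 'I_(16 * r).+1} | in_grid f]%SET.
have card_gridR : #|grid|%:R <= 2 ^+ (18 * r) :> R.
  by rewrite -natrX ler_nat card_grid.
pose bad_sign (fj : {ffun 'I_r -> bool * 'I_(16 * r).+1} * 'I_n) (xi : {ffun 'I_n -> bool}) :=
  b * sqnorm (U *m z fj.1) / n%:R < (H *m sign_diag xi *m (U *m z fj.1)) fj.2 0 ^+ 2.
pose Q (M : 'M[R]_(m, n)) (N : 'M[R]_n) := subspace_embedding eps (M *m H *m N) A.
have -> : [set w | subspace_embedding eps (S w) A] = [set w | Q (Sh w) (D w)].
  by apply/seteqP; split => w /=; rewrite /Q -SE.
(* The factor 1 - delta1 bounds the probability that D flattens the whole grid, and 1 - delta that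
   of hashing for each such D. *)
apply: (@pr_HRHT_ge _ _ _ P m n s Sh D Q
  (fun xi => forall fj, fj \in finset.setX grid [set: 'I_n]%SET -> ~~ bad_sign fj xi)) => //.
- by rewrite subr_ge0 ltW.
- apply: le_trans (pr_union_bound (F := finset.setX grid [set: 'I_n]%SET)
    (bad := bad_sign) (b := 2 * expR (- b / 8)) _ _ _).
  + rewrite lerD2l lerN2 cardsX cardsT card_ord natrM.
    have h1 : expR (- b / 8) <= expR (- (20 * r)%:R) * (delta1 / n%:R).
      have -> : delta1 / n%:R = expR (- ln (n%:R / delta1)).
        by rewrite expRN lnK ?posrE ?divr_gt0// invf_div.
      rewrite -expRD ler_expR /b natrM; lra.
    have h2 := pow2_mul_expRN_le R r0.
    by rewrite -mulrA; apply: union_bound_arith card_gridR (ler0n _ _)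
      (expR_ge0 _) dd0 nR h2 h1.
  + by rewrite card_ffun card_bool expn_gt0.
  + by move=> xi; exact.
  + move=> fj _; apply: sign_flattening_tail => // i j.
    exact: walsh_hadamard_sqr.
move=> xi good.
pose V := H *m sign_diag xi *m U.
have VV : V^T *m V = 1%:M.
  by apply: mulmx_isometry => //; apply: mulmx_isometry => //; exact: sign_diag_orthogonal.
pose bad_hash (f : {ffun 'I_r -> bool * 'I_(16 * r).+1}) c :=
  eps / 3 * sqnorm (z f) <
  `|@hash_err R _ m (fun a : 'I_n * 'I_s => (V *m z f) a.1 0 / Num.sqrt s%:R) c|.
apply: le_trans (pr_union_bound (F := grid) (bad := bad_hash) (b := expR (- 5 * L)) _ _ _).
- rewrite lerD2l lerN2.
  (* The second factor is delta^5 <= delta, and the first one pays for the number of grid points. *)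
  have -> : expR (- 5 * L) = expR (- (20 * r)%:R) * expR (- 5 * ln delta^-1).
    by rewrite -expRD /L natrM; congr expR; ring.
  have h1 : expR (- 5 * ln delta^-1) <= delta.
    rewrite -[leRHS](@lnK _ delta) ?posrE// ler_expR.
    by move: ld0; rewrite lnV ?posrE//; lra.
  have h2 : (2 : R) ^+ (18 * r) * expR (- (20 * r)%:R) <= 1.
    apply: le_trans (pow2_mul_expRN_le R r0); rewrite ler_wpM2r ?expR_ge0//.
    by rewrite ler_peMr ?exprn_ge0// ler1n.
  have h3 := mulr_ge0 (expR_ge0 (- (20 * r)%:R)) (expR_ge0 (- 5 * ln delta^-1)).
  apply: le_trans (ler_wpM2r h3 card_gridR) _; rewrite mulrA.
  rewrite -[leRHS]mul1r; apply: ler_pM h2 h1; last exact: expR_ge0.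
  exact: mulr_ge0 (exprn_ge0 _ (ler0n _ 2)) (expR_ge0 _).
- by rewrite card_prod !card_ffun card_bool card_ord muln_gt0 !expn_gt0 m0.
- move=> c nbad; rewrite /Q AUC; apply: subspace_embedding_net => //; first exact: ltW.
  move=> f gf; rewrite leNgt; have := nbad f; rewrite inE => /(_ gf).
  rewrite /bad_hash -sqnorm_hash_mx// (sqnorm_isometry _ VV).
  by rewrite /V !mulmxA.
move=> f fgrid; have ss : Num.sqrt s%:R ^+ 2 = s%:R :> R by rewrite sqr_sqrtr.
apply: (tail _ eps L E nu (sqnorm (z f)) e m) => //.
- exact: sqrtr_ge0.
- case=> j k /=; have := good (f, j); rewrite finset.in_setX fgrid inE => /(_ isT).
  rewrite /bad_sign/= -leNgt (sqnorm_isometry _ UU) mulmxA -/V => h.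
  rewrite exprMn exprVn ss ler_pdivrMr// nu2.
  apply: le_trans h _; apply: le_of_eq; field; rewrite !gt_eqF//.
transitivity (\sum_j \sum_(k < s) ((V *m z f) j 0 / Num.sqrt s%:R) ^+ 2).
  by rewrite pair_big.
rewrite -(sqnorm_isometry (z f) VV); apply: eq_bigr => j _.
rewrite sumr_const card_ord exprMn exprVn ss.
by rewrite -[LHS]mulr_natr divfK// gt_eqF.
Qed.
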